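(* Let $\mathbb{K}=\mathbb{R}$ or $\mathbb{C}$, let $m\geq 2$ be an integer, let $\lambda_0\in[1,2]$, and let $p$ be a real number with $$\lambda_0 m<p\leq \frac{2\lambda_0(m-1)}{2-\lambda_0},$$ where for $\lambda_0=2$ the right-hand side is understood as $+\infty$ (so that the condition is $2m<p<\infty$). Put $$\eta_1=\frac{\lambda_0 p}{p-\lambda_0 m},\qquad s=\frac{\lambda_0 p}{p-\lambda_0 m+\lambda_0}.$$ Then for every positive integer $n$, every $m$-linear form $T:\ell_p^n\times\cdots\times\ell_p^n\to\mathbb{K}$, and every $i\in\{1,\dots,m\}$, $$\left(\sum_{j_i=1}^{n}\left(\sum_{\widehat{j_i}=1}^{n}\left|T(e_{j_1},\dots,e_{j_m})\right|^{s}\right)^{\frac{1}{s}\eta_1}\right)^{\frac{1}{\eta_1}}\leq A_{\lambda_0}^{\frac{-2(m-1)}{s}}\,\|T\|,$$ where $A_{\lambda_0}$ is the optimal constant of the Khinchin inequality for the scalar field $\mathbb{K}$.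
   Context: $\ell_p^n$ denotes $\mathbb{K}^n$ with the $\ell_p$ norm, $e_1,\dots,e_n$ are the canonical unit vectors, and $\|T\|=\sup\{|T(x_1,\dots,x_m)|:\|x_k\|_{p}\leq 1,\ k=1,\dots,m\}$. The symbol $\sum_{\widehat{j_i}=1}^{n}$ means that the sum runs over all indices $j_1,\dots,j_{i-1},j_{i+1},\dots,j_m\in\{1,\dots,n\}$, i.e. over all indices except $j_i$, which is kept fixed. Khinchin constants. For $\mathbb{K}=\mathbb{R}$ and $q\in[1,2]$, $A_q$ is the optimal (largest) constant such that, for all positive integers $n$ and all scalars $a_1,\dots,a_n$, $$A_q\left(\sum_{j=1}^n|a_j|^2\right)^{1/2}\leq\left(\int_{[0,1]}\left|\sum_{j=1}^n a_j r_j(t)\right|^q dt\right)^{1/q},$$ where $r_j$ are the classical Rademacher functions on $[0,1]$. Its value is $$A_q=\sqrt{2}\left(\frac{\Gamma\left(\frac{1+q}{2}\right)}{\sqrt{\pi}}\right)^{1/q}\ \text{ if } q>q_0,\qquad A_q=2^{\frac12-\frac1q}\ \text{ if } q<q_0,$$ where $q_0\cong 1.85$ is the only real number in $(1,2)$ with $\Gamma\left(\frac{q_0+1}{2}\right)=\frac{\sqrt{\pi}}{2}$ (the two formulas agree at $q=q_0$). For $\mathbb{K}=\mathbb{C}$ and $q\in[1,2]$, $A_q$ is the optimal constant in the analogous inequality with complex scalars and the Rademacher functions replaced by Steinhaus variables (independent random variables uniformly distributed on the complex unit circle), and its value is $A_q=\Gamma\left(\frac{q+2}{2}\right)^{1/q}$.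 *)

(* Defs.v *)
From mathcomp Require Import all_boot all_order all_algebra.
From mathcomp Require Import complex.
From mathcomp Require Import all_classical all_reals all_analysis.

Set Implicit Arguments.
Unset Strict Implicit.
Unset Printing Implicit Defensive.

Import Order.TTheory GRing.Theory Num.Theory.
Import numFieldNormedType.Exports.

Local Open Scope classical_set_scope.
Local Open Scope ring_scope.
Local Open Scope complex_scope.

Inductive scalars := RealScalars | ComplexScalars.

Definition scalar_field (R : realType) (k : scalars) : numFieldType :=
  match k with
  | RealScalars => R
  | ComplexScalars => R[i]
  end.

(* On [R[i]] the MathComp norm takes its values in [R[i]]; [normc] is the same
   modulus with values in [R]. *)
Definition modulus (R : realType) (k : scalars) : scalar_field R k -> R :=
  match k with
  | RealScalars => fun x : R => `|x|
  | ComplexScalars => fun z : R[i] => Normc.normc z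
  end.

Definition rademacher (R : realType) (j : nat) (t : R) : R :=
  Num.sg (sin (2 ^+ j * pi * t)).

(* The functions are r_1, ..., r_n, whence the shift [j.+1] of [j : 'I_n]. *)
Definition real_khinchin (R : realType) (q c : R) : Prop :=
  forall (n : nat) (a : 'I_n -> R), (0 < n)%N ->
    c * Num.sqrt (\sum_(j < n) `|a j| ^+ 2) <=
    (\int[lebesgue_measure]_(t in `[0, 1])
       (`|\sum_(j < n) a j * rademacher j.+1 t| `^ q)) `^ q^-1.

(* Taking [A j = setT] for some of the indices yields the product rule for every
   subfamily. *)
Definition independent_RVs (R : realType) (d d' : measure_display)
    (Omega : measurableType d) (S : measurableType d') (P : probability Omega R)
    (n : nat) (Z : 'I_n -> {RV P >-> S}) : Prop :=
  forall A : 'I_n -> set S, (forall j, measurable (A j)) ->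
    P (\bigcap_(j in [set: 'I_n]) (Z j @^-1` A j)) =
    (\prod_(j < n) P (Z j @^-1` A j))%E.

(* Complex random variables are given by their real and imaginary parts; the
   uniform distribution on the unit circle is the image of the Lebesgue measure
   on [0, 1] by t |-> exp(2 pi i t). *)
Definition steinhaus (R : realType) (d : measure_display)
    (Omega : measurableType d) (P : probability Omega R) (n : nat)
    (Z : 'I_n -> {RV P >-> (measurableTypeR R * measurableTypeR R)%type}) : Prop :=
  independent_RVs Z /\
  forall (j : 'I_n) (A : set (measurableTypeR R * measurableTypeR R)),
    measurable A ->
    distribution P (Z j) A =
    lebesgue_measure
      [set t : R | 0 <= t <= 1 /\ A (cos (2 * pi * t), sin (2 * pi * t))].

Definition complex_khinchin (R : realType) (q c : R) : Prop :=
  forall (d : measure_display) (Omega : measurableType d)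
    (P : probability Omega R) (n : nat)
    (Z : 'I_n -> {RV P >-> (measurableTypeR R * measurableTypeR R)%type})
    (a : 'I_n -> R[i]),
    (0 < n)%N -> steinhaus Z ->
    c * Num.sqrt (\sum_(j < n) Normc.normc (a j) ^+ 2) <=
    (\int[P]_w
       (Normc.normc (\sum_(j < n) a j * ((Z j w).1 +i* (Z j w).2)) `^ q))
      `^ q^-1.

Definition khinchin_const (R : realType) (k : scalars) (q : R) : R :=
  match k with
  | RealScalars => sup [set c : R | real_khinchin q c]
  | ComplexScalars => sup [set c : R | complex_khinchin q c]
  end.

Definition multilinear_form (K : numFieldType) (m n : nat)
    (T : ('I_m -> 'rV[K]_n) -> K) : Prop :=
  forall (x : 'I_m -> 'rV[K]_n) (k : 'I_m) (a : K) (u v : 'rV[K]_n),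
    T (dfwith x k (a *: u + v)) = a * T (dfwith x k u) + T (dfwith x k v).

Definition lp_norm (R : realType) (k : scalars) (n : nat) (p : R)
    (x : 'rV[scalar_field R k]_n) : R :=
  (\sum_(j < n) modulus (x ord0 j) `^ p) `^ p^-1.

Definition form_norm (R : realType) (k : scalars) (m n : nat) (p : R)
    (T : ('I_m -> 'rV[scalar_field R k]_n) -> scalar_field R k) : R :=
  sup [set modulus (T x) | x in
        [set x : 'I_m -> 'rV[scalar_field R k]_n |
          forall l, lp_norm p (x l) <= 1]].

Definition unit_vec (K : numFieldType) (n : nat) (j : 'I_n) : 'rV[K]_n :=
  delta_mx ord0 j.

(* Main.v *)
Require Import Defs.
From HB Require Import structures.
From mathcomp Require Import all_boot all_order all_algebra.
From mathcomp Require Import complex.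
From mathcomp Require Import all_classical all_reals all_analysis.
From mathcomp Require Import measurable_realfun ring lra.

(** Write q for lambda0, A for the Khinchin constant and t_j for the modulus of
T(e_{j_1}, ..., e_{j_m}).

Let first T be bounded by B on the polydisc, where all coordinates of all
arguments have modulus at most 1. Replacing the basis vectors in one variable
by a random point of the polydisc and using the Khinchin inequality for
l_2-valued sums costs a factor A ([vector_khinchin]). Once this has been done
for the m - 1 variables other than the i-th one, the last sum is a value of
the form up to phases, so the sum over j_i of (sum t_j^2)^(q/2) is at most
A^(-(m-1)q) B^q ([mixed_square_sum]). On the other hand, a sum with random
signs is on average at least as large as each of its terms, so the same
elimination bounds the sum over j_i of (max t_j)^q by B^q with constant 1
([mixed_max_sum]). The upper bound on p says that 2 <= s; hence Hoelder's
inequality interpolates between the two estimates, with weight 2/s on the first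
one, and this produces the exponent of A ([mixed_sum]).

To pass to the unit balls of l_p, multiply the variables of T by nonnegative
weights x_l in the unit ball of l_p: the twisted form is bounded by the norm of
T on the polydisc. This gives one inequality for every choice of the weights
and every i. The weights are then chosen explicitly: with S_a the sum of the
t_j^s over the j with j_{i0} = a, the numbers u_j proportional to
t_j^s S_{j_{i0}}^(eta1/s - 1) form a probability, and x_l is the power 1/p of its
l-th marginal. By Jensen's inequality each of the m - 1 inequalities with
i <> i0 becomes a bound for the mean of a product Y_i of powers of marginals,
and the relations 1/s = 1/q - (m-1)/p and 1/eta1 = 1/s - 1/p say precisely that
the product of the Y_i is 1. The inequality between arithmetic and geometric
means finishes the proof ([weighted_sum_bound]).

The constant A is defined as a supremum. It satisfies the Khinchin inequality
itself, because each instance of that inequality is a closed condition on the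
constant; but its positivity has to be proved, since A is raised to a negative
power. This follows from a comparison of the second and fourth moments
([khinchin_of_moments]). For the Rademacher functions these moments are
computed by cutting dyadic intervals in two; for Steinhaus variables, by showing
that each partial sum is independent of the later variables, so that Fubini's
theorem gives recurrences. In the complex case a Steinhaus system must also be
constructed ([steinhaus_exists]), both to bound the admissible constants and to
have something to average over. *)

Set Implicit Arguments.
Unset Strict Implicit.
Unset Printing Implicit Defensive.

Import Order.TTheory GRing.Theory Num.Theory.
Import numFieldNormedType.Exports.

Local Open Scope classical_set_scope.
Local Open Scope ring_scope.

(** * Inequalities for finite sums *)

Section FiniteInequalities.
Context (R : realType).
Implicit Types (th q : R).

(** Young's inequality, with the degenerate exponents 0 and 1 included. *)
Lemma powR_young (x y th : R) : 0 <= x -> 0 <= y -> 0 <= th <= 1 ->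
  x `^ (1 - th) * y `^ th <= (1 - th) * x + th * y.
Proof.
move=> x0 y0 /andP[]; rewrite le_eqVlt => /predU1P[<- _|th0].
  by rewrite subr0 powRr1// powRr0 mulr1 mul1r mul0r addr0.
rewrite le_eqVlt => /predU1P[->|th1].
  by rewrite subrr powRr0 powRr1// !mul1r mul0r add0r.
have th1' : 0 < 1 - th by rewrite subr_gt0.
have := @conjugate_powR R (x `^ (1 - th)) (y `^ th) (1 - th)^-1 th^-1
  (powR_ge0 _ _) (powR_ge0 _ _).
rewrite !invr_gt0 !invrK subrK -!powRrM !divff ?gt_eqF// !powRr1//.
by move=> /(_ th1' th0 erefl); rewrite [x * _]mulrC [y * _]mulrC.
Qed.

(** Hoelder's inequality for finite sums: apply Young's inequality to the
normalized terms u_i / U and v_i / V. *)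
Lemma sum_hoelder (I : finType) (P : pred I) (u v : I -> R) th :
  (forall i, P i -> 0 <= u i) -> (forall i, P i -> 0 <= v i) -> 0 <= th <= 1 ->
  \sum_(i | P i) u i `^ (1 - th) * v i `^ th <=
  (\sum_(i | P i) u i) `^ (1 - th) * (\sum_(i | P i) v i) `^ th.
Proof.
move=> u0 v0 th01; have /andP[th0 th1] := th01.
set U := \sum_(i | P i) u i; set V := \sum_(i | P i) v i.
have [th0'|thN0] := eqVneq th 0.
  rewrite th0' subr0 powRr0 powRr1 ?sumr_ge0// mulr1.
  by apply: ler_sum => i Pi; rewrite powRr0 mulr1 powRr1// u0.
have [th1'|thN1] := eqVneq th 1.
  rewrite th1' subrr powRr0 powRr1 ?sumr_ge0// mul1r.
  by apply: ler_sum => i Pi; rewrite powRr0 mul1r powRr1// v0.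
have U0 : 0 <= U by exact: sumr_ge0.
have V0 : 0 <= V by exact: sumr_ge0.
have [Uz|Up] := eqVneq U 0.
  rewrite Uz powR0 ?subr_eq0 1?eq_sym// mul0r big1// => i Pi.
  have /psumr_eq0P -> // : \sum_(i | P i) u i = 0 by exact: Uz.
  by rewrite powR0 ?mul0r// subr_eq0 eq_sym.
have [Vz|Vp] := eqVneq V 0.
  rewrite Vz powR0// mulr0 big1// => i Pi.
  have /psumr_eq0P -> // : \sum_(i | P i) v i = 0 by exact: Vz.
  by rewrite [X in _ * X]powR0 ?mulr0.
have {}U0 : 0 < U by rewrite lt_neqAle eq_sym Up.
have {}V0 : 0 < V by rewrite lt_neqAle eq_sym Vp.
have UV0 : 0 < U `^ (1 - th) * V `^ th by rewrite mulr_gt0// powR_gt0.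
rewrite -[leRHS]mulr1 -ler_pdivrMl// mulr_sumr.
rewrite (@le_trans _ _ (\sum_(i | P i) ((1 - th) * (u i / U) + th * (v i / V))))//.
  apply: ler_sum => i Pi.
  have Ui := divr_ge0 (u0 _ Pi) (ltW U0); have Vi := divr_ge0 (v0 _ Pi) (ltW V0).
  have := powR_young Ui Vi th01; apply: le_trans.
  rewrite !powRM ?invr_ge0 ?u0 ?v0 ?(ltW U0) ?(ltW V0)//.
  rewrite -(powR_inv1 (ltW U0)) -(powR_inv1 (ltW V0)) -!powRrM !mulN1r !powRN.
  by rewrite le_eqVlt invfM mulrACA [_^-1 * _]mulrC [X in _ * X]mulrC eqxx.
rewrite big_split/= -!mulr_sumr -!mulr_suml -/U -/V !divff ?gt_eqF//.
by rewrite !mulr1 subrK.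
Qed.

(** Jensen's inequality for the concave power th, which is Hoelder's inequality for
the families u and u c. *)
Lemma sum_powR_concave (I : finType) (P : pred I) (u c : I -> R) th :
  (forall i, P i -> 0 <= u i) -> (forall i, P i -> 0 <= c i) -> 0 <= th <= 1 ->
  \sum_(i | P i) u i * c i `^ th <=
  (\sum_(i | P i) u i) `^ (1 - th) * (\sum_(i | P i) u i * c i) `^ th.
Proof.
move=> u0 c0 th01.
apply: le_trans (sum_hoelder u0 _ th01); last by move=> i Pi; rewrite mulr_ge0 ?u0 ?c0.
apply: ler_sum => i Pi.
rewrite powRM ?u0 ?c0// mulrA.
have [->|uN0] := eqVneq (u i) 0; first by rewrite mul0r !mulr_ge0 ?powR_ge0.
by rewrite -powRD ?subrK ?powRr1 ?u0// uN0 implybT.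
Qed.

(** The threshold is y = 2 sqrt v: below it y^2 is controlled by y^q, above it by
y^4. *)
Lemma sqr_le_powR_pow4 (y v q : R) : 0 <= y -> 0 < v -> 1 <= q <= 2 ->
  y ^+ 2 <= 2 `^ (2 - q) * v `^ (1 - q / 2) * y `^ q + (4 * v)^-1 * y ^+ 4.
Proof.
move=> y0 v0 /andP[q1 q2].
have vS : 0 < Num.sqrt v by rewrite sqrtr_gt0.
have vE : Num.sqrt v ^+ 2 = v by rewrite sqr_sqrtr ?ltW.
have -> : 2 `^ (2 - q) * v `^ (1 - q / 2) = (2 * Num.sqrt v) `^ (2 - q).
  rewrite powRM ?ltW// -[in LHS]vE -powR_mulrn ?ltW// -powRrM; congr (_ * _ `^ _).
  by rewrite mulrBr mulr1 mulrCA divff// mulr1.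
have {vE} -> : 4 * v = (2 * Num.sqrt v) ^+ 2 by rewrite exprMn vE; lra.
set K := 2 * _; have K0 : 0 < K by rewrite mulr_gt0.
have [yK|Ky] := leP y K.
  have [->|yN0] := eqVneq y 0; first by rewrite !expr0n/= mulr0 addr0 mulr_ge0 ?powR_ge0.
  rewrite ler_wpDr ?mulr_ge0 ?invr_ge0 ?exprn_ge0 ?(ltW K0)//.
  rewrite [leLHS](_ : _ = y `^ (2 - q) * y `^ q); last first.
    by rewrite -powRD ?subrK ?powR_mulrn// yN0 implybT.
  by rewrite ler_wpM2r ?powR_ge0// ge0_ler_powR ?nnegrE ?(ltW K0)// subr_ge0.
rewrite ler_wpDl ?mulr_ge0 ?powR_ge0//.
rewrite (_ : y ^+ 4 = y ^+ 2 * y ^+ 2); last by rewrite -exprD.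
rewrite mulrA ler_peMl ?exprn_ge0// mulrC ler_pdivlMr ?mul1r ?exprn_gt0//.
by rewrite lerXn2r ?nnegrE ?(ltW K0)// ltW.
Qed.

End FiniteInequalities.

(** * Second and fourth moments *)

Section MomentMethod.
Context d (T : measurableType d) (R : realType).
Variables (mu : {measure set T -> \bar R}) (D : set T).
Hypotheses (mD : measurable D) (muD : mu D = 1%E).

(** Integrating [sqr_le_powR_pow4] gives v <= C E(f^q) + (3/4) v: a fourth moment
of at most 3 v^2 leaves a quarter of the variance to the q-th moment. The
finiteness of E(f^q) matters, because the real-valued integral of a function
with infinite integral is 0. *)
Lemma khinchin_of_moments (f : T -> R) (v q : R) :
  measurable_fun D f -> (forall w, D w -> 0 <= f w) -> 0 < v -> 1 <= q <= 2 ->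
  (\int[mu]_(w in D) (f w ^+ 2)%:E = v%:E)%E ->
  (\int[mu]_(w in D) (f w ^+ 4)%:E <= (3 * v ^+ 2)%:E)%E ->
  2 `^ ((q - 4) / q) * Num.sqrt v <= (\int[mu]_(w in D) (f w `^ q)) `^ q^-1.
Proof.
move=> mf f0 v0 q12 f2 f4.
have /andP[q1 q2] := q12; have q0 : 0 < q := lt_le_trans ltr01 q1.
have mfq : measurable_fun D (fun w => f w `^ q).
  exact: (measurableT_comp (measurable_powR q) mf).
have mf2 : measurable_fun D (fun w => f w ^+ 2) by exact: measurable_funX.
have mf4 : measurable_fun D (fun w => f w ^+ 4) by exact: measurable_funX.
have Ifin : (\int[mu]_(w in D) (f w `^ q)%:E < +oo)%E.
  apply: (@le_lt_trans _ _ (\int[mu]_(w in D) (1%:E + (f w ^+ 2)%:E))%E).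
    apply: ge0_le_integral => //.
    - by move=> w _; rewrite lee_fin powR_ge0.
    - exact/measurable_EFinP.
    - by apply/measurable_EFinP; apply: measurable_funD.
    move=> w Dw; rewrite -EFinD lee_fin; have fw0 := f0 _ Dw.
    have [fw1|fw1] := leP (f w) 1.
      have := @ge0_ler_powR R q (ltW q0) (f w) 1.
      by rewrite !nnegrE fw0 ler01 powR1 => /(_ isT isT fw1) ?; rewrite ler_wpDr ?sqr_ge0.
    by rewrite ler_wpDl// -powR_mulrn// ler_powR// ltW.
  rewrite ge0_integralD//; first last.
  - exact/measurable_EFinP.
  - by move=> w _; rewrite lee_fin sqr_ge0.
  by rewrite f2 integral_cst// muD mule1 -EFinD ltry.
have I0 : (0 <= \int[mu]_(w in D) (f w `^ q)%:E)%E.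
  by apply: integral_ge0 => w _; rewrite lee_fin powR_ge0.
rewrite /Rintegral; set I := (\int[mu]_(w in D) _)%E in Ifin I0 *.
have IE : I = (fine I)%:E by rewrite fineK// ge0_fin_numE.
set r := fine I in IE *; have r0 : 0 <= r by rewrite -lee_fin -IE.
set C := 2 `^ (2 - q) * v `^ (1 - q / 2).
have C0 : 0 < C by rewrite mulr_gt0// powR_gt0.
have vC : v <= C * r + (4 * v)^-1 * (3 * v ^+ 2).
  rewrite -lee_fin -f2.
  apply: (@le_trans _ _ (\int[mu]_(w in D)
      (C%:E * (f w `^ q)%:E + ((4 * v)^-1)%:E * (f w ^+ 4)%:E))%E).
    apply: ge0_le_integral => //.
    - by move=> w _; rewrite lee_fin sqr_ge0.
    - exact/measurable_EFinP.
    - apply/measurable_EFinP; apply: measurable_funD; exact: measurable_funM.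
    by move=> w Dw; rewrite -!EFinM -EFinD lee_fin; apply: sqr_le_powR_pow4 => //; exact: f0.
  have v4 : 0 <= (4 * v)^-1 by rewrite invr_ge0 mulr_ge0// ltW.
  rewrite ge0_integralD//; first last.
  - by apply/measurable_EFinP; exact: measurable_funM.
  - by move=> w Dw; rewrite -EFinM lee_fin mulr_ge0// exprn_ge0// f0.
  - by apply/measurable_EFinP; exact: measurable_funM.
  - by move=> w Dw; rewrite -EFinM lee_fin mulr_ge0 ?powR_ge0// ltW.
  rewrite (ge0_integralZl mu mD _ _ _ (k := C%:E)) ?lee_fin ?(ltW C0)//; first last.
  - by move=> w _; rewrite lee_fin powR_ge0.
  - exact/measurable_EFinP.
  rewrite (ge0_integralZl mu mD _ _ _ (k := (4 * v)^-1%:E)) ?lee_fin//; first last.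
  - by move=> w Dw; rewrite lee_fin exprn_ge0// f0.
  - exact/measurable_EFinP.
  rewrite -/I IE !EFinD !(EFinM _ r) (EFinM (_^-1)) leeD2l//.
  by rewrite lee_wpmul2l// lee_fin.
have {vC} vr : v / 4 <= C * r.
  have E : (4 * v)^-1 * (3 * v ^+ 2) = 3 / 4 * v.
    by field; rewrite gt_eqF.
  by move: vC; rewrite E; lra.
have {vr} : 2 `^ (q - 4) * v `^ (q / 2) <= r.
  rewrite -(ler_pM2l C0) (le_trans _ vr)// /C.
  rewrite mulrACA -!powRD ?(gt_eqF v0) ?pnatr_eq0 ?implybT//.
  rewrite (_ : 2 - q + (q - 4) = - 2%:R); last by lra.
  by rewrite subrK (powRr1 (ltW v0)) powR_invn// mulrC ler_pM2l// -natrX.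
move=> /(ge0_ler_powR (r := q^-1)); rewrite invr_ge0 (ltW q0) !nnegrE mulr_ge0 ?powR_ge0//.
move=> /(_ isT isT r0); rewrite powRM ?powR_ge0// -!powRrM.
by rewrite mulrAC divff ?gt_eqF// mul1r (powR12_sqrt (ltW v0)).
Qed.

End MomentMethod.

(** * Rademacher sums *)

Section Rademacher.
Context (R : realType).
Local Notation mu := (@lebesgue_measure R).
Implicit Types (a : nat -> R) (g : R -> R) (x : R).

Lemma measurable_rademacher j (D : set R) : measurable_fun D (@rademacher R j).
Proof.
apply: measurable_funTS.
rewrite (_ : @rademacher R j = fun t =>
   if sin (2 ^+ j * pi * t) == 0 then 0 else
   if sin (2 ^+ j * pi * t) < 0 then -1 else 1); last first.
  by apply/funext => t; rewrite /rademacher; case: sgrP.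
have ms : measurable_fun setT (fun t : R => sin (2 ^+ j * pi * t)).
  apply: (measurableT_comp (f := sin)).
    by apply: continuous_measurable_fun; exact: continuous_sin.
  exact: measurable_funM.
apply: measurable_fun_ifT => //=; first exact: measurable_fun_eqr.
apply: measurable_fun_ifT => //=; exact: measurable_fun_ltr.
Qed.

Lemma normr_rademacher_le1 j (t : R) : `|rademacher j t| <= 1.
Proof. by rewrite normr_sg lern1 leq_b1. Qed.

Lemma sinDnatpi (k : nat) (x : R) : sin (x + pi * k%:R) = (-1) ^+ k * sin x.
Proof.
elim: k => [|k IH]; first by rewrite mulr0 addr0 expr0 mul1r.
by rewrite -natr1 mulrDr mulr1 addrA sinDpi IH exprS mulN1r mulNr.
Qed.

(** The interval has to be open: Rademacher functions vanish at dyadic points. *)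
Lemma rademacher_dyadic j k (t : R) :
  k%:R / 2 ^+ j < t < k.+1%:R / 2 ^+ j -> rademacher j t = (-1) ^+ k.
Proof.
rewrite ltr_pdivrMr ?exprn_gt0// ltr_pdivlMr ?exprn_gt0// => /andP[tk kt].
pose y := pi * (t * 2 ^+ j - k%:R).
have -> : rademacher j t = Num.sg ((-1) ^+ k * sin y).
  by rewrite -sinDnatpi /rademacher /y -mulrDr subrK; congr (Num.sg (sin _)); ring.
rewrite sgrM [X in _ * X]gtr0_sg ?mulr1.
  by rewrite sgrX sgrN1.
apply: sin_gt0_pi; rewrite mulr_gt0 ?pi_gt0 ?subr_gt0//=.
rewrite gtr_pMr ?pi_gt0// ltrBlDl; by rewrite natr1.
Qed.

(** The mean of g (x + sum_j eps_j a_j) over all the signs eps_j. *)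
Fixpoint sign_average g (n : nat) a x : R :=
  if n is n'.+1 then
    (sign_average g n' (fun j => a j.+1) (x + a 0) +
     sign_average g n' (fun j => a j.+1) (x - a 0)) / 2
  else g x.

Lemma measurable_rademacher_sum g n l a x (D : set R) : continuous g ->
  measurable_fun D (fun t => g (x + \sum_(j < n) a j * rademacher (l + j).+1 t)).
Proof.
move=> cg; apply: (measurableT_comp (continuous_measurable_fun cg)).
apply: measurable_funD => //; apply: measurable_sum => j.
by apply: measurable_funM => //; exact: measurable_rademacher.
Qed.

(** On each half of a dyadic interval of order l the function of index l + 1 is
constant, so its value can be absorbed in x; the other functions see the half as
a dyadic interval of order l + 1. *)
Lemma integral_rademacher_dyadic g n : continuous g -> (forall y, 0 <= g y) ->
  forall l k a x,
  (\int[mu]_(t in `[(k%:R / 2 ^+ l)%R, (k.+1%:R / 2 ^+ l)%R[)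
    (g (x + \sum_(j < n) a j * rademacher (l + j).+1 t)%R)%:E =
  (sign_average g n a x / 2 ^+ l)%:E)%E.
Proof.
move=> cg g0; elim: n => [|n IH] l k a x.
  under eq_integral do rewrite big_ord0 addr0.
  rewrite integral_cst//= lebesgue_measure_itv/= lte_fin.
  rewrite ltr_pM2r ?invr_gt0 ?exprn_gt0// ltr_nat ltnSn -EFinD -EFinM.
  by rewrite -mulrBl -natrB// subSnn mul1r.
(* b = 0 is the left half, b = 1 the right one; the left endpoint is dropped
   because the Rademacher function vanishes there. *)
have half (b : nat) :
    (\int[mu]_(t in `[((2 * k + b)%:R / 2 ^+ l.+1)%R, ((2 * k + b).+1%:R / 2 ^+ l.+1)%R[)
    (g (x + \sum_(j < n.+1) a j * rademacher (l + j).+1 t)%R)%:E =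
   (sign_average g n (fun j => a j.+1) (x + a 0 * (-1) ^+ b) / 2 ^+ l.+1)%:E)%E.
  rewrite -(IH l.+1 (2 * k + b)%N (fun j => a j.+1) (x + a 0 * (-1) ^+ b)).
  rewrite -integral_itv_obnd_cbnd; last first.
    apply/measurable_EFinP.
    exact: (@measurable_rademacher_sum g n.+1 l a x _ cg).
  rewrite -[RHS]integral_itv_obnd_cbnd; last first.
    apply/measurable_EFinP.
    exact: (@measurable_rademacher_sum g n l.+1 (fun j => a j.+1) _ _ cg).
  apply: eq_integral => t; rewrite inE/= in_itv/= => /rademacher_dyadic rE.
  rewrite big_ord_recl addn0 rE exprD exprM sqrrN expr1n expr1n mul1r addrA.
  by congr (g (_ + _))%:E; apply: eq_bigr => j _; rewrite !lift0 addnS.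
have H0 := half 0; have H1 := half 1.
rewrite addn0 expr0 mulr1 in H0; rewrite addn1 expr1 mulrN1 in H1.
set c : R := (2 * k).+1%:R / 2 ^+ l.+1.
have Ea : k%:R / 2 ^+ l = (2 * k)%:R / 2 ^+ l.+1 :> R.
  by rewrite natrM exprS -mulf_div divff// mul1r.
have Eb : k.+1%:R / 2 ^+ l = (2 * k).+2%:R / 2 ^+ l.+1 :> R.
  rewrite (_ : (2 * k).+2 = 2 * k.+1)%N; last by rewrite mulnS.
  by rewrite natrM exprS -mulf_div divff// mul1r.
rewrite Ea Eb (@itv_bndbnd_setU _ _ _ (BLeft c))//=; first last.
- by rewrite bnd_simp ler_pM2r ?invr_gt0 ?exprn_gt0// ler_nat.
- by rewrite bnd_simp ler_pM2r ?invr_gt0 ?exprn_gt0// ler_nat.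
rewrite ge0_integral_setU//=; first last.
- apply/disj_setPS => t [] /=; rewrite !in_itv/= => /andP[_ tc] /andP[ct _].
  by move: (le_lt_trans ct tc); rewrite ltxx.
- by move=> t _; rewrite lee_fin.
- by apply/measurable_EFinP; exact: (@measurable_rademacher_sum g n.+1 l a x _ cg).
rewrite H0 H1 -EFinD; congr EFin.
by rewrite -mulrDl exprS invfM mulrA.
Qed.

Lemma integral_rademacher g n a : continuous g -> (forall y, 0 <= g y) ->
  (\int[mu]_(t in `[0%R, 1%R])
    (g (\sum_(j < n) a j * rademacher j.+1 t)%R)%:E = (sign_average g n a 0)%:E)%E.
Proof.
move=> cg g0; have := integral_rademacher_dyadic n cg g0 0 0 a 0.
rewrite expr0 !divr1 -integral_itv_bndo_bndc => [<-|]; last first.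
  apply/measurable_EFinP.
  have := @measurable_rademacher_sum g n 0 a 0 `[0, 1[ cg.
  by apply: eq_measurable_fun => t _; rewrite add0r.
by apply: eq_integral => t _; rewrite add0r.
Qed.

Lemma sign_average_sqr n a x :
  sign_average (fun y => y ^+ 2) n a x = x ^+ 2 + \sum_(j < n) a j ^+ 2.
Proof.
elim: n a x => [|n IH] a x /=; first by rewrite big_ord0 addr0.
rewrite !IH big_ord_recl (eq_bigr (fun i : 'I_n => a i.+1 ^+ 2))//.
set s := \sum_(i < n) _; rewrite -[a ord0]/(a 0); lra.
Qed.

Lemma sign_average_pow4 n a x :
  sign_average (fun y => y ^+ 4) n a x <=
  x ^+ 4 + 6 * x ^+ 2 * (\sum_(j < n) a j ^+ 2) + 3 * (\sum_(j < n) a j ^+ 2) ^+ 2.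
Proof.
elim: n a x => [|n IH] a x /=; first by rewrite big_ord0; lra.
rewrite big_ord_recl (eq_bigr (fun i : 'I_n => a i.+1 ^+ 2))//.
have := IH (fun j => a j.+1) (x + a 0); have := IH (fun j => a j.+1) (x - a 0).
set s := \sum_(i < n) _; rewrite -[a ord0]/(a 0) => H1 H2.
have := sqr_ge0 (a 0 ^+ 2); lra.
Qed.

(** The value is far from optimal; only its positivity matters. *)
Lemma real_khinchin_pos (q : R) : 1 <= q <= 2 -> real_khinchin q (2 `^ ((q - 4) / q)).
Proof.
move=> q12 n a n0.
pose a' (j : nat) := a (insubd (Ordinal n0) j).
have a'E (j : 'I_n) : a' j = a j by rewrite /a' valKd.
have q0 : 0 < q by case/andP: q12 => + _; apply: lt_le_trans.
have -> : \sum_(j < n) `|a j| ^+ 2 = \sum_(j < n) a' j ^+ 2.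
  by apply: eq_bigr => j _; rewrite a'E -normrX ger0_norm ?sqr_ge0.
set v := \sum_(j < n) _.
have : 0 <= v by rewrite sumr_ge0// => j _; rewrite sqr_ge0.
rewrite le_eqVlt => /predU1P[<-|v0]; first by rewrite sqrtr0 mulr0 powR_ge0.
have cX k : continuous (fun y : R => y ^+ k) by exact: exprn_continuous.
apply: khinchin_of_moments => //.
- apply: etrans (lebesgue_measure_itv `[(0 : R), 1]) _.
  by rewrite /= lte_fin ltr01 oppr0 adde0.
- apply: (measurableT_comp (@normr_measurable R setT)).
  by apply: measurable_sum => j; apply: measurable_funM => //; exact: measurable_rademacher.
- under eq_integral => t _.
    rewrite -normrX ger0_norm ?sqr_ge0//.
    under eq_bigr do rewrite -a'E.
    over.
  rewrite (@integral_rademacher (fun y => y ^+ 2) n a')//; last by move=> y; rewrite sqr_ge0.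
  by rewrite sign_average_sqr expr0n add0r.
- under eq_integral => t _.
    rewrite -normrX ger0_norm ?exprn_even_ge0//.
    under eq_bigr do rewrite -a'E.
    over.
  rewrite (@integral_rademacher (fun y => y ^+ 4) n a')//; last first.
    by move=> y; rewrite exprn_even_ge0.
  rewrite lee_fin (le_trans (sign_average_pow4 _ _ _))//.
  by rewrite !expr0n/= mulr0 mul0r !add0r.
Qed.

End Rademacher.

(** * The uniform distribution on the circle *)

Local Notation plane R := (measurableTypeR R * measurableTypeR R)%type.

Section UniformCircle.
Context (R : realType).

Definition circle_point (t : measurableTypeR R) : plane R :=
  (cos (2 * pi * t), sin (2 * pi * t)).

Lemma measurable_circle_point : measurable_fun setT circle_point.
Proof.
have m2 : measurable_fun setT (fun t : measurableTypeR R => 2 * pi * t).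
  exact: measurable_funM.
apply: measurable_fun_pair.
- apply: (measurableT_comp (f := cos)) => //.
  by apply: continuous_measurable_fun; exact: continuous_cos.
- apply: (measurableT_comp (f := sin)) => //.
  by apply: continuous_measurable_fun; exact: continuous_sin.
Qed.

HB.instance Definition _ :=
  isMeasurableFun.Build _ _ _ _ circle_point measurable_circle_point.

Definition unit_uniform : probability (measurableTypeR R) R := uniform_prob (@ltr01 R).

Lemma unit_uniformE (A : set R) : measurable A ->
  unit_uniform A = lebesgue_measure (A `&` `[0, 1]).
Proof.
move=> mA.
have := @integral_uniform R 0 1 ltr01 (fun x => (\1_A x)%:E).
rewrite integral_indic// setIT subr0 invr1 mul1e integral_indic// => -> //.
apply/measurable_EFinP; exact: measurable_indic.
Qed.

Lemma circle_lawE (A : set (plane R)) : measurable A ->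
  distribution unit_uniform circle_point A =
  lebesgue_measure
    [set t : R | 0 <= t <= 1 /\ A (cos (2 * pi * t), sin (2 * pi * t))].
Proof.
move=> mA; rewrite [LHS]unit_uniformE//.
  by congr lebesgue_measure; apply/seteqP; split=> t /=; rewrite in_itv/=; case.
by rewrite -[X in measurable X]setTI; exact: measurable_circle_point.
Qed.

Lemma integral_circle_law (h : plane R -> R) :
  measurable_fun setT h -> (forall z, 0 <= h z) ->
  (\int[distribution unit_uniform circle_point]_z (h z)%:E =
   \int[lebesgue_measure]_(t in `[0%R, 1%R]) (h (circle_point t))%:E)%E.
Proof.
move=> mh h0.
rewrite ge0_integral_distribution//; last first.
  exact/measurable_EFinP.
have -> := @integral_uniform R 0 1 ltr01 (EFin \o h \o circle_point).
- by rewrite subr0 invr1 mul1e.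
- by apply/measurable_EFinP; exact: (measurableT_comp mh measurable_circle_point).
- by move=> t; rewrite lee_fin.
Qed.

Lemma integral_derive01 (F f : R -> R) :
  continuous f -> (forall t : R, is_derive t 1 F (f t)) ->
  (\int[lebesgue_measure]_(t in `[0%R, 1%R]) (f t)%:E = (F 1 - F 0)%:E)%E.
Proof.
move=> cf dF.
have cF : continuous F.
  move=> t; apply/differentiable_continuous/derivable1_diffP.
  by have [] := dF t.
rewrite (@continuous_FTC2 R f F 0 1)//.
- exact: continuous_subspaceT.
- split.
  + by move=> t _; have [] := dF t.
  + by apply: cvg_at_right_filter; exact: cF.
  + by apply: cvg_at_left_filter; exact: cF.
- by move=> t _; rewrite derive1E; have [] := dF t.
Qed.

(** A primitive of the integrand is al t plus a function of period 1. *)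
Lemma integral_trig (al be ga : R) :
  (\int[lebesgue_measure]_(t in `[0%R, 1%R])
     (al + be * (circle_point t).1 + ga * (circle_point t).2)%R%:E = al%:E)%E.
Proof.
set w : R := 2 * pi.
have wN0 : w != 0 by rewrite mulf_neq0 ?pnatr_eq0// gt_eqF// pi_gt0.
have wE : w = pi *+ 2 by rewrite /w mulr_natl.
have dl (t : R) : is_derive t 1 (w \*: (@id R)) w.
  by apply: is_derive_eq; rewrite -[RHS]mulr1.
have cl : continuous (w \*: (@id R)).
  move=> t; apply/differentiable_continuous/derivable1_diffP.
  by have [] := dl t.
have dS (t : R) : is_derive t 1 (w^-1 \*: (sin \o (w \*: (@id R)))) (cos (w * t)).
  have H : is_derive t 1 (sin \o (w \*: (@id R))) (cos (w * t) * w).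
    exact: is_derive1_comp.
  by apply: is_derive_eq; rewrite /GRing.scale/= mulrCA mulVf// mulr1.
have dC (t : R) : is_derive t 1 ((- w^-1) \*: (cos \o (w \*: (@id R)))) (sin (w * t)).
  have H : is_derive t 1 (cos \o (w \*: (@id R))) (- sin (w * t) * w).
    exact: is_derive1_comp.
  by apply: is_derive_eq; rewrite /GRing.scale/= mulNr mulNr mulrN opprK mulrCA mulVf// mulr1.
have dF (t : R) : is_derive t 1
    (al \*: (@id R) + (be \*: (w^-1 \*: (sin \o (w \*: (@id R)))) +
     ga \*: ((- w^-1) \*: (cos \o (w \*: (@id R))))))
    (al + be * cos (w * t) + ga * sin (w * t)).
  have d0 : is_derive t 1 (al \*: (@id R)) al.
    by apply: is_derive_eq; rewrite -[RHS]mulr1.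
  have d1 : is_derive t 1 (be \*: (w^-1 \*: (sin \o (w \*: (@id R)))))
      (be * cos (w * t)) by exact: is_deriveZ.
  have d2 : is_derive t 1 (ga \*: ((- w^-1) \*: (cos \o (w \*: (@id R)))))
      (ga * sin (w * t)) by exact: is_deriveZ.
  by rewrite -addrA; apply: is_deriveD.
apply: etrans (integral_derive01 _ dF) _.
  have cc : continuous (fun t => cos (w * t)).
    by move=> t; apply: continuous_comp; [exact: cl|exact: continuous_cos].
  have cs : continuous (fun t => sin (w * t)).
    by move=> t; apply: continuous_comp; [exact: cl|exact: continuous_sin].
  move=> t; apply: cvgD; first apply: cvgD.
  - exact: cvg_cst.
  - by apply: cvgM; [exact: cvg_cst|exact: cc].
  - by apply: cvgM; [exact: cvg_cst|exact: cs].
rewrite !fctE /= /GRing.scale/= !mulr1 !mulr0 wE sin2pi sin0 cos2pi cos0.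
by congr EFin; ring.
Qed.

End UniformCircle.

(** * Partial sums of Steinhaus variables *)

Lemma sum_ord_ltS (V : nmodType) (n k : nat) (kn : (k < n)%N) (F : 'I_n -> V) :
  \sum_(j < n | (j < k.+1)%N) F j = \sum_(j < n | (j < k)%N) F j + F (Ordinal kn).
Proof.
rewrite (bigD1 (Ordinal kn))//= addrC; congr (_ + _); apply: eq_bigl => j.
by rewrite ltnS -val_eqE/= ltn_neqAle andbC.
Qed.

Lemma measure_rect_unique d1 d2 (T1 : measurableType d1) (T2 : measurableType d2)
    (R : realType) (m1 m2 : {measure set (T1 * T2) -> \bar R}) :
  (m1 setT < +oo)%E ->
  (forall A B, measurable A -> measurable B -> m1 (A `*` B) = m2 (A `*` B)) ->
  forall C, measurable C -> m1 C = m2 C.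
Proof.
move=> m1oo m12 C mC.
pose G : set (set (T1 * T2)) :=
  [set C | exists A, measurable A /\ exists B, measurable B /\ C = A `*` B].
apply: (measure_unique G (fun=> setT)) => //.
- rewrite measurable_prod_measurableType; congr (<<s _ >>).
  apply/seteqP; split => [_ [A mA [B mB <-]]|_ [A [mA [B [mB ->]]]]].
    by exists A; split => //; exists B.
  by exists A => //; exists B.
- move=> _ _ [X1 [mX1 [X2 [mX2 ->]]]] [Y1 [mY1 [Y2 [mY2 ->]]]].
  rewrite -setXI; exists (X1 `&` Y1); split; first exact: measurableI.
  by exists (X2 `&` Y2); split => //; exact: measurableI.
- by move=> _; exists setT; split => //; exists setT; split => //; rewrite setXTT.
- by rewrite bigcup_const.
- by move=> _ [A [mA [B [mB ->]]]]; exact: m12.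
Qed.

Section SteinhausWalk.
Context d (Omega : measurableType d) (R : realType) (P : probability Omega R).
Context (n : nat) (Z : 'I_n -> {RV P >-> plane R}).
Hypothesis indepZ : independent_RVs Z.
Variables (u v : 'I_n -> R).

(** Complex notation: (x, z) is sent to x + (u + i v) z. *)
Definition walk_step (u v : R) (xz : plane R * plane R) : plane R :=
  (xz.1.1 + (u * xz.2.1 - v * xz.2.2), xz.1.2 + (u * xz.2.2 + v * xz.2.1)).

(** The k-th partial sum of the variables Z j multiplied by u j + i v j. *)
Definition walk (k : nat) (w : Omega) : plane R :=
  (\sum_(j < n | (j < k)%N) (u j * (Z j w).1 - v j * (Z j w).2),
   \sum_(j < n | (j < k)%N) (u j * (Z j w).2 + v j * (Z j w).1)).

Lemma walkS k (kn : (k < n)%N) w :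
  walk k.+1 w = walk_step (u (Ordinal kn)) (v (Ordinal kn)) (walk k w, Z (Ordinal kn) w).
Proof. by rewrite /walk !sum_ord_ltS. Qed.

Lemma measurable_walk_step a b : measurable_fun setT (walk_step a b).
Proof.
have m1 : measurable_fun setT (fun xz : plane R * plane R => xz.1.1).
  by apply: (measurableT_comp (f := fst)).
have m2 : measurable_fun setT (fun xz : plane R * plane R => xz.1.2).
  by apply: (measurableT_comp (f := snd)).
have m3 : measurable_fun setT (fun xz : plane R * plane R => xz.2.1).
  by apply: (measurableT_comp (f := fst)).
have m4 : measurable_fun setT (fun xz : plane R * plane R => xz.2.2).
  by apply: (measurableT_comp (f := snd)).
apply: measurable_fun_pair; apply: measurable_funD => //.
- by apply: measurable_funB; exact: measurable_funM.
- by apply: measurable_funD; exact: measurable_funM.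
Qed.

Lemma measurable_walk k : measurable_fun setT (walk k).
Proof.
have m1 j : measurable_fun setT (fun w => (Z j w).1).
  by apply: (measurableT_comp (f := fst)) => //; exact: measurable_funPT.
have m2 j : measurable_fun setT (fun w => (Z j w).2).
  by apply: (measurableT_comp (f := snd)) => //; exact: measurable_funPT.
have mc a j : measurable_fun setT (fun w => a * (Z j w).1).
  by apply: measurable_funM => //; exact: m1.
have mc' a j : measurable_fun setT (fun w => a * (Z j w).2).
  by apply: measurable_funM => //; exact: m2.
apply: measurable_fun_pair; under eq_fun do rewrite big_mkcond;
  apply: measurable_sum => j; case: (_ < _)%N => //.
- exact: (measurable_funB (mc _ _) (mc' _ _)).
- exact: measurable_funD.
Qed.

HB.instance Definition _ k :=
  isMeasurableFun.Build _ _ _ _ (walk k) (measurable_walk k).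

Definition tail_event (k : nat) (B : 'I_n -> set (plane R)) : set Omega :=
  \bigcap_(j in [set j : 'I_n | (k <= j)%N]) (Z j @^-1` B j).

Lemma measurable_preZ j (B : set (plane R)) : measurable B -> measurable (Z j @^-1` B).
Proof.
by move=> mB; rewrite -[X in measurable X]setTI; apply: measurable_funPT => //.
Qed.

Lemma measurable_tail k B : (forall j, measurable (B j)) -> measurable (tail_event k B).
Proof.
move=> mB; apply: fin_bigcap_measurable; first exact: finite_finset.
by move=> j _; exact: (measurable_preZ _ (mB j)).
Qed.

Lemma tail_eventS k (kn : (k < n)%N) B :
  tail_event k B = Z (Ordinal kn) @^-1` B (Ordinal kn) `&` tail_event k.+1 B.
Proof.
apply/seteqP; split => [w h|w [h1 h2] j /= kj].
  split; first by apply: (h (Ordinal kn)) => /=.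
  by move=> j kj; apply: h; exact: ltnW.
have [jk|jk] := eqVneq j (Ordinal kn); first by rewrite jk.
apply: h2 => /=; rewrite ltn_neqAle kj andbT.
by apply: contra jk => /eqP jk; apply/eqP/val_inj.
Qed.

(** Induction on k. For fixed sets B_j, j > k, both sides for k + 1, regarded as
functions of the event for the pair (partial sum, Z_k), are finite measures on
the product of two planes; by the induction hypothesis they agree on
rectangles, hence everywhere. *)
Lemma walk_tail_indep k A B : (k <= n)%N ->
  measurable A -> (forall j, measurable (B j)) ->
  P (walk k @^-1` A `&` tail_event k B) =
  (P (walk k @^-1` A) * \prod_(j < n | (k <= j)%N) P (Z j @^-1` B j))%E.
Proof.
elim: k A B => [|k IH] A B kn mA mB.
  have -> : walk 0 = cst (0, 0).
    by apply/funext => w; rewrite /walk !big_pred0.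
  have PB : P (tail_event 0 B) = (\prod_(j < n | (0 <= j)%N) P (Z j @^-1` B j))%E.
    rewrite -(indepZ mB) /tail_event; congr (P (bigcap _ _)).
    by apply/seteqP; split.
  have [A0|A0] := pselect (A (0, 0)).
    by rewrite preimage_cst mem_set// setTI probability_setT mul1e.
  by rewrite preimage_cst memNset// set0I measure0 mul0e.
pose o := Ordinal kn.
have kn' := ltnW kn.
have stepE : walk k.+1 = walk_step (u o) (v o) \o (fun w => (walk k w, Z o w)).
  by apply/funext => w; rewrite walkS.
have mW : measurable_fun setT (fun w => (walk k w, Z o w)).
  apply: measurable_fun_pair; [exact: measurable_walk|exact: measurable_funPT].
have rect A1 B1 D : measurable A1 -> measurable B1 -> (forall j, measurable (D j)) ->
    P (walk k @^-1` A1 `&` Z o @^-1` B1 `&` tail_event k.+1 D) =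
    (P (walk k @^-1` A1) * P (Z o @^-1` B1) *
     \prod_(j < n | (k.+1 <= j)%N) P (Z j @^-1` D j))%E.
  move=> mA1 mB1 mD; pose D' j := if j == o then B1 else D j.
  have mD' j : measurable (D' j) by rewrite /D'; case: ifP.
  have := IH A1 D' kn' mA1 mD'.
  rewrite (tail_eventS kn) {1}/D' eqxx setIA => E.
  have D'E (j : 'I_n) : (k < j)%N -> D' j = D j.
    by move=> kj; rewrite /D' -val_eqE/= gtn_eqF.
  have tE : tail_event k.+1 D' = tail_event k.+1 D.
    by apply: eq_bigcapr => j /= kj; rewrite D'E.
  rewrite -tE E -muleA (bigD1 o)//= {1}/D' eqxx; congr (_ * (_ * _))%E.
  apply: eq_big => [j|j /andP[kj jo]].
    by rewrite [RHS]ltn_neqAle andbC eq_sym.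
  by rewrite D'E// ltn_neqAle kj andbT eq_sym.
have prod_ge0 : (0 <= \prod_(j < n | (k.+1 <= j)%N) P (Z j @^-1` B j))%E.
  by apply: prode_ge0 => j _.
have prod_fin : (\prod_(j < n | (k.+1 <= j)%N) P (Z j @^-1` B j))%E \is a fin_num.
  apply: prode_fin_num => j _; apply: fin_num_measure; exact: measurable_preZ.
set c := (\prod_(j < n | _) _)%E in prod_ge0 prod_fin *.
have c0 : 0 <= fine c by rewrite fine_ge0.
pose m1 : {measure set (plane R * plane R) -> \bar R} :=
  pushforward (mrestr P (measurable_tail k.+1 mB)) (fun w => (walk k w, Z o w)).
pose m0 : {measure set (plane R * plane R) -> \bar R} :=
  pushforward P (fun w => (walk k w, Z o w)).
pose m2 : {measure set (plane R * plane R) -> \bar R} := mscale (NngNum c0) (m0 mW).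
have m12 : forall C, measurable C -> m1 mW C = m2 C.
  apply: measure_rect_unique.
    rewrite /m1/= /pushforward /mrestr preimage_setT setTI.
    apply: le_lt_trans (ltry 1); apply: probability_le1; exact: measurable_tail.
  move=> A1 B1 mA1 mB1.
  rewrite /m1 /m2/= /mscale/= /pushforward /mrestr/= fineK//.
  have := rect A1 B1 B mA1 mB1 mB; rewrite -/c => ->.
  have := rect A1 B1 (fun=> setT) mA1 mB1 (fun=> measurableT).
  have -> : tail_event k.+1 (fun=> setT) = setT.
    by apply/seteqP; split => // w _ j _.
  rewrite setIT => ->.
  by rewrite muleC big1 ?mule1// => j _; rewrite preimage_setT probability_setT.
have mC : measurable (walk_step (u o) (v o) @^-1` A).
  by rewrite -[X in measurable X]setTI; exact: measurable_walk_step.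
have := m12 _ mC; rewrite /m1 /m2/= /mscale/= /pushforward /mrestr/= fineK// stepE.
by rewrite muleC.
Qed.

End SteinhausWalk.

Section SteinhausMoments.
Context d (Omega : measurableType d) (R : realType) (P : probability Omega R).
Context (n : nat) (Z : 'I_n -> {RV P >-> plane R}).
Hypothesis hZ : steinhaus Z.
Variables (u v : 'I_n -> R).

Lemma walk_pair_law k (kn : (k < n)%N) C : measurable C ->
  P ((fun w => (walk Z u v k w, Z (Ordinal kn) w)) @^-1` C) =
  (distribution P (walk Z u v k) \x distribution P (Z (Ordinal kn)))%E C.
Proof.
move=> mC; set o := Ordinal kn.
have mW : measurable_fun setT (fun w => (walk Z u v k w, Z o w)).
  by apply: measurable_fun_pair; [exact: measurable_walk|exact: measurable_funPT].
pose m0 : {measure set (plane R * plane R) -> \bar R} :=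
  pushforward P (fun w => (walk Z u v k w, Z o w)).
apply/esym.
apply: (@product_measure_unique _ _ _ _ _ (distribution P (walk Z u v k))
  (distribution P (Z o)) (m0 mW)) => // A B mA mB.
pose D (j : 'I_n) := if j == o then B else setT.
have mD j : measurable (D j) by rewrite /D; case: ifP.
have := walk_tail_indep hZ.1 u v (ltnW kn) mA mD.
have -> : tail_event Z k D = Z o @^-1` B.
  apply/seteqP; split => [w /(_ o (leqnn k))|w Bw j /= _]; rewrite /D /= ?eqxx//.
  by case: eqP => // ->.
rewrite (bigD1 o)//= big1 ?mule1; last first.
  by move=> j /andP[_ /negbTE jo]; rewrite /D jo preimage_setT probability_setT.
by rewrite {1}/D eqxx.
Qed.

(** The pair (partial sum, next variable) has a product law, so Fubini's theorem
averages first over the next variable, which is uniform on the circle. *)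
Lemma integral_walkS k (kn : (k < n)%N) (h : plane R -> R) :
  measurable_fun setT h -> (forall z, 0 <= h z) ->
  (\int[P]_w (h (walk Z u v k.+1 w))%:E =
   \int[P]_w \int[lebesgue_measure]_(t in `[0%R, 1%R])
     (h (walk_step (u (Ordinal kn)) (v (Ordinal kn)) (walk Z u v k w, circle_point t)))%:E)%E.
Proof.
move=> mh h0; set o := Ordinal kn.
have mW : measurable_fun setT (fun w => (walk Z u v k w, Z o w)).
  by apply: measurable_fun_pair; [exact: measurable_walk|exact: measurable_funPT].
pose m0 : {measure set (plane R * plane R) -> \bar R} :=
  pushforward P (fun w => (walk Z u v k w, Z o w)).
have mhs : measurable_fun setT (fun xz => (h (walk_step (u o) (v o) xz))%:E).
  by apply/measurable_EFinP; apply: (measurableT_comp mh); exact: measurable_walk_step.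
have e0 : (\int[P]_w (h (walk Z u v k.+1 w))%:E =
    \int[m0 mW]_xz (h (walk_step (u o) (v o) xz))%:E)%E.
  rewrite /m0/= ge0_integral_pushforward//=; last by move=> y _; rewrite lee_fin.
  by rewrite preimage_setT; apply: eq_integral => w _; rewrite walkS.
rewrite e0 (@eq_measure_integral _ _ _ setT
  (distribution P (walk Z u v k) \x distribution P (Z o))%E); last first.
  by move=> C mC _; exact: (walk_pair_law kn mC).
rewrite fubini_tonelli1//; last by move=> xz; rewrite lee_fin.
rewrite ge0_integral_distribution; last 2 first.
- by apply: measurable_fun_fubini_tonelli_F => // xz; rewrite lee_fin.
- by move=> x; apply: integral_ge0 => z _; rewrite lee_fin.
apply: eq_integral => w _ /=; rewrite /fubini_F.
rewrite (@eq_measure_integral _ _ _ setT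
  (distribution (unit_uniform R) (@circle_point R))); last first.
  by move=> C mC _; exact: etrans (hZ.2 o C mC) (esym (circle_lawE mC)).
rewrite integral_circle_law//.
apply: (measurableT_comp mh).
by have /measurable_fun_pair2 := measurable_walk_step (u o) (v o); apply.
Qed.

Lemma measurable_circle_average (a b : R) (h : plane R -> R) :
  measurable_fun setT h -> (forall z, 0 <= h z) ->
  measurable_fun setT (fun x : plane R =>
    \int[lebesgue_measure]_(t in `[0%R, 1%R])
      (h (walk_step a b (x, circle_point t)))%:E)%E.
Proof.
move=> mh h0.
have mhs : measurable_fun setT (fun xz => h (walk_step a b xz)).
  by apply: (measurableT_comp mh); exact: measurable_walk_step.
rewrite (_ : (fun x => _) = fubini_F (distribution (unit_uniform R) (@circle_point R))
    (fun xz => (h (walk_step a b xz))%:E)).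
  apply: measurable_fun_fubini_tonelli_F; first exact/measurable_EFinP.
  by move=> xz; rewrite lee_fin.
apply/funext => x; rewrite /fubini_F integral_circle_law//.
by have /measurable_fun_pair2 := mhs; apply.
Qed.

Definition sqnorm (x : plane R) : R := x.1 ^+ 2 + x.2 ^+ 2.

Lemma sqnorm_ge0 x : 0 <= sqnorm x.
Proof. by rewrite addr_ge0 ?sqr_ge0. Qed.

Lemma measurable_sqnorm : measurable_fun setT sqnorm.
Proof.
apply: measurable_funD; apply: measurable_funX.
- exact: measurable_fst.
- exact: measurable_snd.
Qed.

Lemma sqnorm_walk_step (a b : R) (x : plane R) (t : measurableTypeR R) :
  sqnorm (walk_step a b (x, circle_point t)) =
  (sqnorm x + (a ^+ 2 + b ^+ 2)) + (2 * (a * x.1 + b * x.2)) * (circle_point t).1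
    + (2 * (a * x.2 - b * x.1)) * (circle_point t).2.
Proof.
rewrite /sqnorm /=; set c := cos _; set s := sin _.
have cs : c ^+ 2 = 1 - s ^+ 2 by rewrite -(cos2Dsin2 (2 * pi * t)) addrK.
by ring: cs.
Qed.

Lemma integral_sqnorm_step (a b : R) (x : plane R) :
  (\int[lebesgue_measure]_(t in `[0%R, 1%R])
     (sqnorm (walk_step a b (x, circle_point t)))%:E =
   (sqnorm x + (a ^+ 2 + b ^+ 2))%:E)%E.
Proof. by under eq_integral do rewrite sqnorm_walk_step; exact: integral_trig. Qed.

(** On the circle the squared norm of the next sum is al + be c + ga s with
c^2 + s^2 = 1. In its square the cross terms with al have mean 0, and
(be c + ga s)^2 <= be^2 + ga^2 by the Cauchy-Schwarz inequality. *)
Lemma integral_sqnorm2_step (a b : R) (x : plane R) :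
  (\int[lebesgue_measure]_(t in `[0%R, 1%R])
     (sqnorm (walk_step a b (x, circle_point t)) ^+ 2)%:E <=
   (sqnorm x ^+ 2 + 6 * (a ^+ 2 + b ^+ 2) * sqnorm x + (a ^+ 2 + b ^+ 2) ^+ 2)%:E)%E.
Proof.
set r := a ^+ 2 + b ^+ 2; set al := sqnorm x + r.
set be := 2 * (a * x.1 + b * x.2); set ga := 2 * (a * x.2 - b * x.1).
have -> : sqnorm x ^+ 2 + 6 * r * sqnorm x + r ^+ 2 = al ^+ 2 + be ^+ 2 + ga ^+ 2.
  by rewrite /al /be /ga /r /sqnorm; ring.
rewrite -(integral_trig (al ^+ 2 + be ^+ 2 + ga ^+ 2) (2 * al * be) (2 * al * ga)).
have m1 : measurable_fun setT (fun t : measurableTypeR R => (circle_point t).1).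
  by apply: (measurableT_comp measurable_fst); exact: measurable_circle_point.
have m2 : measurable_fun setT (fun t : measurableTypeR R => (circle_point t).2).
  by apply: (measurableT_comp measurable_snd); exact: measurable_circle_point.
apply: ge0_le_integral => //.
- by move=> t _; rewrite lee_fin sqr_ge0.
- apply: measurable_funTS; apply/measurable_EFinP; apply: measurable_funX.
  apply: (measurableT_comp measurable_sqnorm).
  by have /measurable_fun_pair2 := @measurable_walk_step R a b; move=> /(_ x) H;
    apply: (measurableT_comp H); exact: measurable_circle_point.
- apply: measurable_funTS; apply/measurable_EFinP.
  by apply: measurable_funD; [apply: measurable_funD => //|]; apply: measurable_funM.
move=> t _; rewrite lee_fin sqnorm_walk_step -/r -/al -/be -/ga.
set c := (circle_point t).1; set s := (circle_point t).2.
have cs : c ^+ 2 = 1 - s ^+ 2 by rewrite -(cos2Dsin2 (2 * pi * t)) addrK.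
rewrite -subr_ge0.
have -> : al ^+ 2 + be ^+ 2 + ga ^+ 2 + 2 * al * be * c + 2 * al * ga * s -
  (al + be * c + ga * s) ^+ 2 = (be * s - ga * c) ^+ 2 by ring: cs.
exact: sqr_ge0.
Qed.

(** The variance of the k-th partial sum. *)
Let var k := \sum_(j < n | (j < k)%N) (u j ^+ 2 + v j ^+ 2).

Lemma walk_second_moment k : (k <= n)%N ->
  (\int[P]_w (sqnorm (walk Z u v k w))%:E = (var k)%:E)%E.
Proof.
elim: k => [|k IH] kn.
  rewrite /var big_pred0// integral0_eq// => w _.
  by rewrite /walk !big_pred0// /sqnorm/= expr0n addr0.
rewrite (integral_walkS kn); [|exact: measurable_sqnorm|exact: sqnorm_ge0].
under eq_integral do rewrite integral_sqnorm_step EFinD.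
rewrite ge0_integralD//; first last.
- by move=> w _; rewrite lee_fin addr_ge0 ?sqr_ge0.
- apply/measurable_EFinP; apply: (measurableT_comp measurable_sqnorm).
  exact: measurable_walk.
- by move=> w _; rewrite lee_fin sqnorm_ge0.
rewrite IH ?(ltnW kn)//.
rewrite integral_cst// [X in (_ * X)%E]probability_setT mule1 -EFinD; congr EFin.
exact/esym/sum_ord_ltS.
Qed.

Lemma walk_fourth_moment k : (k <= n)%N ->
  (\int[P]_w (sqnorm (walk Z u v k w) ^+ 2)%:E <= (3 * var k ^+ 2)%:E)%E.
Proof.
elim: k => [|k IH] kn.
  rewrite integral0_eq => [|w _]; first by rewrite lee_fin mulr_ge0// exprn_even_ge0.
  by rewrite /walk !big_pred0// /sqnorm/= expr0n addr0 expr0n.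
have ms : measurable_fun setT (fun w => sqnorm (walk Z u v k w)).
  apply: (measurableT_comp measurable_sqnorm); exact: measurable_walk.
rewrite (integral_walkS kn (h := fun x => sqnorm x ^+ 2)); first last.
- by move=> x; exact: sqr_ge0.
- by apply: measurable_funX; exact: measurable_sqnorm.
set o := Ordinal kn; set r := u o ^+ 2 + v o ^+ 2.
have r0 : 0 <= r by rewrite addr_ge0 ?sqr_ge0.
apply: (@le_trans _ _ (\int[P]_w ((sqnorm (walk Z u v k w) ^+ 2)%:E +
    ((6 * r)%:E * (sqnorm (walk Z u v k w))%:E + (r ^+ 2)%:E)))%E).
  apply: ge0_le_integral => //.
  - by move=> w _; apply: integral_ge0 => t _; rewrite lee_fin sqr_ge0.
  - have := measurable_circle_average (u o) (v o)
      (measurable_funX 2 measurable_sqnorm) (fun z => sqr_ge0 (sqnorm z)).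
    by move=> /measurableT_comp; apply; exact: measurable_walk.
  - apply/measurable_EFinP; apply: measurable_funD; first exact: measurable_funX.
    by apply: measurable_funD => //; exact: measurable_funM.
  move=> w _; rewrite -EFinM -!EFinD addrA; exact: integral_sqnorm2_step.
rewrite ge0_integralD//; first last.
- apply/measurable_EFinP; apply: measurable_funD => //; exact: measurable_funM.
- by move=> w _; rewrite -EFinM -EFinD lee_fin addr_ge0 ?mulr_ge0 ?sqr_ge0 ?sqnorm_ge0.
- by apply/measurable_EFinP; exact: measurable_funX.
- by move=> w _; rewrite lee_fin sqr_ge0.
rewrite ge0_integralD//; first last.
- by move=> w _; rewrite lee_fin sqr_ge0.
- apply/measurable_EFinP; exact: measurable_funM.
- by move=> w _; rewrite -EFinM lee_fin !mulr_ge0 ?sqnorm_ge0.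
rewrite ge0_integralZl//; first last.
- by rewrite lee_fin mulr_ge0.
- by move=> w _; rewrite lee_fin sqnorm_ge0.
- exact/measurable_EFinP.
rewrite walk_second_moment ?(ltnW kn)// integral_cst//.
rewrite [X in (_ + _ * X)%E]probability_setT mule1.
apply: (@le_trans _ _ ((3 * var k ^+ 2)%:E + ((6 * r * var k)%:E + (r ^+ 2)%:E))%E).
  by rewrite leeD2r// IH// ltnW.
rewrite -!EFinD lee_fin [var k.+1](sum_ord_ltS kn) -/(var k) -/r.
have := sqr_ge0 r; lra.
Qed.

End SteinhausMoments.

(** * Positivity and attainment of the Khinchin constants *)

Section KhinchinConstants.
Local Open Scope complex_scope.

Lemma normc_steinhaus_sum (R : realType) d (Om : measurableType d) (P : probability Om R)
    (n : nat) (Z : 'I_n -> {RV P >-> plane R}) (a : 'I_n -> R[i]) w :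
  Normc.normc (\sum_(j < n) a j * ((Z j w).1 +i* (Z j w).2)) =
  Num.sqrt (sqnorm (walk Z (fun j => complex.Re (a j)) (fun j => complex.Im (a j)) n w)).
Proof.
set u := fun j => complex.Re (a j); set v := fun j => complex.Im (a j).
rewrite (_ : \sum_(j < n) _ = (walk Z u v n w).1 +i* (walk Z u v n w).2)//.
have -> : walk Z u v n w = (\sum_(j < n) (u j * (Z j w).1 - v j * (Z j w).2),
    \sum_(j < n) (u j * (Z j w).2 + v j * (Z j w).1)).
  by rewrite /walk; congr pair; apply: eq_bigl => j; rewrite ltn_ord.
apply/eqP; rewrite eq_complex !raddf_sum/=; apply/andP; split; apply/eqP;
  by apply: eq_bigr => j _; rewrite /u /v; case: (a j).
Qed.

Lemma measurable_steinhaus_sum (R : realType) d (Om : measurableType d)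
    (P : probability Om R) (n : nat) (Z : 'I_n -> {RV P >-> plane R}) (a : 'I_n -> R[i]) :
  measurable_fun setT
    (fun w => Normc.normc (\sum_(j < n) a j * ((Z j w).1 +i* (Z j w).2))).
Proof.
under eq_fun do rewrite normc_steinhaus_sum.
apply: (measurableT_comp (continuous_measurable_fun (@sqrt_continuous R))).
by apply: (measurableT_comp (@measurable_sqnorm R)); exact: measurable_walk.
Qed.

Lemma complex_khinchin_pos (R : realType) (q : R) : 1 <= q <= 2 ->
  complex_khinchin q (2 `^ ((q - 4) / q)).
Proof.
move=> q12 d Om P n Z a n0 hZ.
pose u j := complex.Re (a j); pose v j := complex.Im (a j).
have sE : \sum_(j < n) Normc.normc (a j) ^+ 2 =
    \sum_(j < n | (j < n)%N) (u j ^+ 2 + v j ^+ 2).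
  apply: eq_big => [j|j _]; first by rewrite ltn_ord.
  by rewrite /u /v; case: (a j) => x y /=; rewrite sqr_sqrtr// addr_ge0 ?sqr_ge0.
have w2 := walk_second_moment hZ u v (leqnn n).
have w4 := walk_fourth_moment hZ u v (leqnn n).
rewrite sE; set V := \sum_(j < n | _) _ in w2 w4 *.
have : 0 <= V by rewrite sumr_ge0// => j _; rewrite addr_ge0 ?sqr_ge0.
rewrite le_eqVlt => /predU1P[<-|V0]; first by rewrite sqrtr0 mulr0 powR_ge0.
have s2 w : Num.sqrt (sqnorm (walk Z u v n w)) ^+ 2 = sqnorm (walk Z u v n w).
  by rewrite sqr_sqrtr// sqnorm_ge0.
apply: khinchin_of_moments => //.
- exact: probability_setT.
- exact: measurable_steinhaus_sum.
- by move=> w _; rewrite normc_steinhaus_sum sqrtr_ge0.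
- by under eq_integral do rewrite normc_steinhaus_sum s2.
- by under eq_integral do rewrite normc_steinhaus_sum (exprM _ 2 2) s2.
Qed.

(** Adjoin an independent copy of [0, 1] with the uniform distribution to the
probability space and let the new variable be the point of the circle that it
parametrizes. *)
Lemma steinhaus_exists (R : realType) (n : nat) :
  exists (d : measure_display) (Om : measurableType d) (P : probability Om R)
    (Z : 'I_n -> {RV P >-> plane R}),
  steinhaus Z /\ forall j w, Normc.normc ((Z j w).1 +i* (Z j w).2) = 1.
Proof.
elim: n => [|n [d [Om [P [Z [[indZ lawZ] normZ]]]]]].
  have Z (j : 'I_0) : {RV (unit_uniform R) >-> plane R} by case: j.
  exists _, _, (unit_uniform R), Z; split; last by case.
  split; last by case.
  move=> A mA; rewrite big_ord0 (_ : \bigcap_(j in _) _ = setT) ?probability_setT//.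
  by apply/seteqP; split => // w _ [].
pose Q := (P \x unit_uniform R)%E : probability _ R.
pose Z0 (j : 'I_n.+1) : (Om * measurableTypeR R)%type -> plane R :=
  if unlift ord0 j is Some i then Z i \o fst else @circle_point R \o snd.
have mZ0 j : measurable_fun setT (Z0 j).
  rewrite /Z0; case: unlift => [i|]; first exact: measurableT_comp.
  exact: (measurableT_comp (@measurable_circle_point R) measurable_snd).
pose Z' j : {RV Q >-> plane R} :=
  HB.pack (Z0 j) (isMeasurableFun.Build _ _ _ _ (Z0 j) (mZ0 j)).
have Z'0 : Z' ord0 = @circle_point R \o snd :> (_ -> _).
  by rewrite /= /Z0 unlift_none.
have Z'l i : Z' (lift ord0 i) = Z i \o fst :> (_ -> _).
  by rewrite /= /Z0 liftK.
have mpre i B : measurable B -> measurable (Z i @^-1` B).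
  by move=> mB; rewrite -[X in measurable X]setTI; apply: measurable_funPT.
have mpre0 B : measurable B -> measurable (@circle_point R @^-1` B).
  by move=> mB; rewrite -[X in measurable X]setTI; exact: measurable_circle_point.
have Q0 B : measurable B ->
    Q (Z' ord0 @^-1` B) = unit_uniform R (@circle_point R @^-1` B).
  move=> mB; rewrite Z'0 (_ : _ @^-1` _ = setT `*` (@circle_point R @^-1` B)); last first.
    by apply/seteqP; split => [[x y]|[x y] []].
  rewrite [LHS]product_measure1E//; last exact: mpre0.
  by rewrite [X in (X * _)%E]probability_setT mul1e.
have Ql i B : measurable B -> Q (Z' (lift ord0 i) @^-1` B) = P (Z i @^-1` B).
  move=> mB; rewrite Z'l (_ : _ @^-1` _ = (Z i @^-1` B) `*` setT); last first.
    by apply/seteqP; split => [[x y]|[x y] []].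
  rewrite [LHS]product_measure1E//; last exact: mpre.
  by rewrite [X in (_ * X)%E]probability_setT mule1.
exists _, _, Q, Z'; split; last first.
  move=> j w; case: (unliftP ord0 j) => [i|] ->.
    by rewrite Z'l; exact: normZ.
  by rewrite Z'0 /= cos2Dsin2 sqrtr1.
split; last first.
  move=> j A mA; case: (unliftP ord0 j) => [i|] ->.
    by rewrite -(lawZ i)//; exact: Ql.
  by rewrite -circle_lawE//; exact: Q0.
move=> A mA; rewrite big_ord_recl Q0//.
under eq_bigr do rewrite Ql//.
rewrite -(indZ (fun i => A (lift ord0 i)))//.
rewrite (_ : \bigcap_(j in _) _ =
  (\bigcap_(i in [set: 'I_n]) Z i @^-1` A (lift ord0 i)) `*` (@circle_point R @^-1` A ord0)).
  rewrite [LHS]product_measure1E//; [by rewrite muleC| |exact: mpre0].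
  apply: fin_bigcap_measurable; first exact: finite_finset.
  by move=> i _; exact: mpre.
apply/seteqP; split => [[x y] h|[x y] [h1 h2] j _].
  split => [i _|].
    have : A (lift ord0 i) ((Z' (lift ord0 i) : _ -> _) (x, y)) by exact: (h _ I).
    by rewrite Z'l.
  have : A ord0 ((Z' ord0 : _ -> _) (x, y)) by exact: (h _ I).
  by rewrite Z'0.
case: (unliftP ord0 j) => [i|] ->.
  have : A (lift ord0 i) ((Z i \o fst) (x, y)) by exact: (h1 i I).
  by rewrite -Z'l.
have : A ord0 ((@circle_point R \o snd) (x, y)) by exact: h2.
by rewrite -Z'0.
Qed.

(** Why a Khinchin constant satisfies its own inequality: each instance of it is a
closed condition on the constant. *)
Lemma sup_mul_le (R : realType) (S : set R) (x y : R) : S !=set0 -> 0 <= x ->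
  (forall c, S c -> c * x <= y) -> sup S * x <= y.
Proof.
move=> S0 x0 H; have [xz|xN0] := eqVneq x 0.
  by case: S0 => c /H; rewrite xz !mulr0.
have {xN0}x0 : 0 < x by rewrite lt_neqAle eq_sym xN0.
by rewrite -ler_pdivlMr//; apply: ge_sup => // c /H; rewrite ler_pdivlMr.
Qed.

Lemma khinchin_const_real (R : realType) (q : R) : 1 <= q <= 2 ->
  0 < khinchin_const RealScalars q /\ real_khinchin q (khinchin_const RealScalars q).
Proof.
move=> q12; have c0 := real_khinchin_pos q12.
split.
  apply: lt_le_trans (_ : 2 `^ ((q - 4) / q) <= _); first by rewrite powR_gt0.
  (* The inequality for a single coefficient bounds the set from above. *)
  apply: ub_le_sup => //.
  have /= := fun c (h : real_khinchin q c) => h 1 (fun=> 1) (ltn0Sn 0).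
  rewrite big_ord1 normr1 expr1n sqrtr1 => h.
  by eexists => c /= /h; rewrite mulr1; exact.
move=> n a n0; apply: sup_mul_le; [by eexists; exact: c0|exact: sqrtr_ge0|].
by move=> c; apply.
Qed.

Lemma khinchin_const_complex (R : realType) (q : R) : 1 <= q <= 2 ->
  0 < khinchin_const ComplexScalars q /\
  complex_khinchin q (khinchin_const ComplexScalars q).
Proof.
move=> q12; have c0 := complex_khinchin_pos q12.
split.
  apply: lt_le_trans (_ : 2 `^ ((q - 4) / q) <= _); first by rewrite powR_gt0.
  apply: ub_le_sup => //.
  have [d [Om [P [Z [hZ _]]]]] := steinhaus_exists R 1.
  have := fun c (h : complex_khinchin q c) => h d Om P 1 Z (fun=> 1) (ltn0Sn 0) hZ.
  rewrite big_ord1 Normc.normc1 expr1n sqrtr1 => h.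
  by eexists => c /= /h; rewrite mulr1; exact.
move=> d Om P n Z a n0 hZ.
apply: sup_mul_le; [by eexists; exact: c0|exact: sqrtr_ge0|].
by move=> c; apply.
Qed.

End KhinchinConstants.

(** * The modulus on the scalar field *)

Section Modulus.
Local Open Scope complex_scope.
Context (R : realType) (k : scalars).
Local Notation K := (scalar_field R k).
Implicit Types x y : K.

Lemma modulus_ge0 x : 0 <= modulus x.
Proof. by case: k x => x /=; [exact: normr_ge0|case: x => a b; exact: sqrtr_ge0]. Qed.

Lemma modulusM x y : modulus (x * y) = modulus x * modulus y.
Proof. by case: k x y => x y /=; [exact: normrM|exact: Normc.normcM]. Qed.

Lemma modulusD x y : modulus (x + y) <= modulus x + modulus y.
Proof. by case: k x y => x y /=; [exact: ler_normD|exact: le_normcD]. Qed.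

Lemma modulus0 : modulus (0 : K) = 0.
Proof. by case: k; [exact: normr0|exact: Normc.normc0]. Qed.

Lemma modulus1 : modulus (1 : K) = 1.
Proof. by case: k; [exact: normr1|exact: Normc.normc1]. Qed.

Lemma modulusN1 : modulus (- 1 : K) = 1.
Proof. by case: k; [rewrite /= normrN1|rewrite /= oppr0 sqrrN expr1n expr0n addr0 sqrtr1]. Qed.

Lemma modulus2 : modulus (2 : K) = 2.
Proof.
case: k; first by rewrite /= ger0_norm.
by rewrite /= !addr0 expr0n addr0 sqrtr_sqr ger0_norm.
Qed.

Lemma modulus_sum (I : Type) (s : seq I) (P : pred I) (F : I -> K) :
  modulus (\sum_(i <- s | P i) F i) <= \sum_(i <- s | P i) modulus (F i).
Proof.
elim/big_rec2: _ => [|i y x _ yx]; first by rewrite modulus0.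
by apply: le_trans (modulusD _ _) _; rewrite lerD2l.
Qed.

Definition embed_real (r : R) : K :=
  match k return scalar_field R k with
  | RealScalars => r
  | ComplexScalars => r%:C
  end.

Lemma embed_real_sum (I : Type) (s : seq I) (P : pred I) (F : I -> R) :
  embed_real (\sum_(i <- s | P i) F i) = \sum_(i <- s | P i) embed_real (F i).
Proof. by rewrite /embed_real; case: k => //=; rewrite rmorph_sum. Qed.

Lemma modulus_embed_real (r : R) : modulus (embed_real r) = `|r|.
Proof. by rewrite /embed_real; case: k => //=; rewrite expr0n addr0 sqrtr_sqr. Qed.

Lemma modulus_eq0 x : modulus x = 0 -> x = 0.
Proof. by case: k x => x /=; [exact: normr0_eq0|exact: Normc.eq0_normc]. Qed.

Lemma exists_phase x : exists y : K, modulus y <= 1 /\ x * y = embed_real (modulus x).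
Proof.
have [->|x0] := eqVneq x 0.
  exists 1; rewrite modulus1 mul0r modulus0; split=> //.
  by rewrite /embed_real; case: k.
exists (embed_real (modulus x) / x); split; last by rewrite mulrC divfK.
have nx0 : modulus x != 0 by apply: contra x0 => /eqP/modulus_eq0 ->.
suff -> : modulus (embed_real (modulus x) / x) = 1 by [].
apply: (mulIf nx0); rewrite -modulusM divfK// modulus_embed_real mul1r.
by rewrite ger0_norm// modulus_ge0.
Qed.

End Modulus.

(** * Averaging over one variable *)

Section VectorKhinchin.
Local Open Scope complex_scope.
Context (R : realType) (k : scalars) (q : R).
Local Notation K := (scalar_field R k).
Hypothesis q12 : 1 <= q <= 2.

Lemma khinchin_const_gt0 : 0 < khinchin_const k q.
Proof.
by case: k; [have [] := khinchin_const_real q12|have [] := khinchin_const_complex q12].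
Qed.

(** A common form of the real and complex cases: random points of the polydisc for
which the Khinchin inequality holds with the optimal constant. The moduli are
only bounded by 1 because Rademacher functions vanish at dyadic points. *)
Lemma khinchin_system (n : nat) : (0 < n)%N ->
  exists (d : measure_display) (T : measurableType d) (mu : {measure set T -> \bar R})
    (D : set T) (z : T -> 'I_n -> K),
  [/\ measurable D, mu D = 1%E,
    forall w j, D w -> modulus (z w j) <= 1,
    forall a : 'I_n -> K, measurable_fun D (fun w => modulus (\sum_j a j * z w j)) &
    forall a : 'I_n -> K, khinchin_const k q * Num.sqrt (\sum_j modulus (a j) ^+ 2) <=
      (\int[mu]_(w in D) (modulus (\sum_j a j * z w j) `^ q)) `^ q^-1].
Proof.
move=> n0; case: k.
- exists _, (measurableTypeR R), lebesgue_measure, [set` `[(0 : R), 1]],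
    (fun t (j : 'I_n) => rademacher j.+1 t).
  split => //.
  + apply: etrans (lebesgue_measure_itv `[(0 : R), 1]) _.
    by rewrite /= lte_fin ltr01 oppr0 adde0.
  + by move=> t j _; exact: normr_rademacher_le1.
  + move=> a; apply: (measurableT_comp (@normr_measurable R setT)).
    by apply: measurable_sum => j; apply: measurable_funM => //; exact: measurable_rademacher.
  + by move=> a; have [_] := khinchin_const_real q12; apply.
- have [d [Om [P [Z [hZ normZ]]]]] := steinhaus_exists R n.
  exists d, Om, P, setT, (fun w j => (Z j w).1 +i* (Z j w).2).
  split => //.
  + exact: probability_setT.
  + by move=> w j _; have /= -> := normZ j w.
  + by move=> a; exact: measurable_steinhaus_sum.
  + by move=> a; have [_] := khinchin_const_complex q12; apply.
Qed.

(** The Khinchin inequality for l_2-valued sums, with the expectation replaced by an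
upper bound M over the polydisc. With U_l the square sum of the coefficients of the
l-th component and B the sum of the U_l, concavity of the power q/2 for the
weights U_l / B bounds (sum_l g_l^2)^(q/2) below by a combination of the g_l^q; the
scalar inequality applies to each of these, and the total is A^q B^(q/2). *)
Lemma vector_khinchin (I L : finType) (n : nat) (P : I -> pred L)
    (a : I -> L -> 'I_n -> K) (M : R) : (0 < n)%N ->
  (forall z : 'I_n -> K, (forall j, modulus (z j) <= 1) ->
    \sum_i (\sum_(l | P i l) modulus (\sum_j a i l j * z j) ^+ 2) `^ (q / 2) <= M) ->
  khinchin_const k q `^ q *
    \sum_i (\sum_(l | P i l) \sum_j modulus (a i l j) ^+ 2) `^ (q / 2) <= M.
Proof.
move=> n0 HM; have /andP[q1 q2] := q12.
have q0 : 0 < q := lt_le_trans ltr01 q1.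
have th01 : 0 <= q / 2 <= 1 by rewrite divr_ge0 ?(ltW q0)// ler_pdivrMr// mul1r.
have qh0 : q / 2 != 0 by rewrite mulf_neq0 ?gt_eqF ?invr_gt0.
set A := khinchin_const k q.
have A0 : 0 <= A by rewrite ltW// khinchin_const_gt0.
pose U i l := \sum_j modulus (a i l j) ^+ 2.
have U0 i l : 0 <= U i l by rewrite sumr_ge0// => j _; rewrite sqr_ge0.
pose B i := \sum_(l | P i l) U i l.
have B0 i : 0 <= B i by exact: sumr_ge0.
have [d [T [mu [D [z [mD muD zle mz hz]]]]]] := khinchin_system n0.
pose g i l w := modulus (\sum_j a i l j * z w j).
have g0 i l w : 0 <= g i l w by exact: modulus_ge0.
(* The coefficient of g_l^q in the lower bound is B^(q/2-1) U_l^(1-q/2), but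
   with the value 0 when U_l = 0, also for q = 2; hence the quotient. *)
pose c i l := if P i l then B i `^ (q / 2 - 1) * U i l / U i l `^ (q / 2) else 0.
have c0 i l : 0 <= c i l.
  by rewrite /c; case: ifP => // _; rewrite divr_ge0 ?mulr_ge0 ?powR_ge0.
have bound w : D w -> \sum_(x : I * L) c x.1 x.2 * g x.1 x.2 w `^ q <= M.
  move=> Dw; have zw := fun j => zle w j Dw.
  apply: le_trans (HM (z w) zw).
  rewrite -(pair_bigA _ (fun i l => c i l * g i l w `^ q))/=; apply: ler_sum => i _.
  rewrite (bigID (P i))/= [X in _ + X]big1 ?addr0; last first.
    by move=> l /negbTE Pil; rewrite /c Pil mul0r.
  have S0 : 0 <= \sum_(l | P i l) g i l w ^+ 2.
    by apply: sumr_ge0 => l _; rewrite sqr_ge0.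
  have [Bz|BN0] := eqVneq (B i) 0.
    rewrite big1 ?powR_ge0// => l Pil.
    rewrite /c Pil; have /psumr_eq0P -> // : \sum_(l | P i l) U i l = 0 by exact: Bz.
    by rewrite mulr0 !mul0r.
  have {BN0}Bp : 0 < B i by rewrite lt_neqAle eq_sym BN0 B0.
  pose r l := g i l w ^+ 2 / U i l.
  have r0 l : 0 <= r l by rewrite divr_ge0// sqr_ge0.
  have := @sum_powR_concave R L (P i) (U i) r (q / 2)
    (fun l _ => U0 i l) (fun l _ => r0 l) th01.
  rewrite -/(B i) => conc.
  have -> : \sum_(l | P i l) c i l * g i l w `^ q =
      B i `^ (q / 2 - 1) * \sum_(l | P i l) U i l * r l `^ (q / 2).
    rewrite mulr_sumr; apply: eq_bigr => l Pil; rewrite /c Pil -!mulrA; congr (_ * (_ * _)).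
    rewrite /r powRM ?sqr_ge0 ?invr_ge0// -powR_mulrn// -powRrM mulrCA divff// mulr1.
    by rewrite -(powR_inv1 (U0 i l)) -powRrM mulN1r powRN mulrC.
  apply: (@le_trans _ _ (B i `^ (q / 2 - 1) *
    (B i `^ (1 - q / 2) * (\sum_(l | P i l) U i l * r l) `^ (q / 2)))).
    by rewrite ler_wpM2l// powR_ge0.
  rewrite mulrA -powRD; last by rewrite (gt_eqF Bp) implybT.
  rewrite (_ : q / 2 - 1 + (1 - q / 2) = 0); last by ring.
  rewrite powRr0 mul1r ge0_ler_powR ?nnegrE//; first by case/andP: th01.
  - by apply: sumr_ge0 => l _; rewrite mulr_ge0.
  apply: ler_sum => l _; rewrite /r.
  have [->|UN0] := eqVneq (U i l) 0; first by rewrite mul0r sqr_ge0.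
  by rewrite mulrC divfK.
have mg i l : measurable_fun D (fun w => g i l w `^ q).
  exact: (measurableT_comp (measurable_powR q) (mz (a i l))).
have Ig i l : ((A `^ q * U i l `^ (q / 2))%:E <= \int[mu]_(w in D) (g i l w `^ q)%:E)%E.
  have I0 : (0 <= \int[mu]_(w in D) (g i l w `^ q)%:E)%E.
    by apply: integral_ge0 => w _; rewrite lee_fin powR_ge0.
  apply: (@le_trans _ _ (fine (\int[mu]_(w in D) (g i l w `^ q)%:E)%E)%:E); last first.
    by move: I0; case: (\int[mu]_(w in D) _)%E => //= *; rewrite leey.
  rewrite lee_fin; have := hz (a i l).
  move=> /(ge0_ler_powR (ltW q0)); rewrite !nnegrE mulr_ge0 ?sqrtr_ge0 ?powR_ge0//.
  move=> /(_ isT isT); rewrite -powRrM mulVf ?gt_eqF// powRr1 ?fine_ge0//.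
  have e : Num.sqrt (U i l) `^ q = U i l `^ (q / 2).
    by rewrite -(powR12_sqrt (U0 i l)) -powRrM mulrC.
  by rewrite -/(U i l) -/A powRM ?sqrtr_ge0// e.
rewrite -lee_fin.
apply: (@le_trans _ _ (\int[mu]_(w in D)
  (\sum_(x : I * L) (c x.1 x.2)%:E * (g x.1 x.2 w `^ q)%:E))%E); last first.
  apply: (@le_trans _ _ (\int[mu]_(w in D) (cst M%:E w))%E).
    apply: ge0_le_integral => //.
    - by move=> w _; apply: sume_ge0 => x _; rewrite -EFinM lee_fin mulr_ge0 ?powR_ge0.
    - apply: emeasurable_sum => x; apply/measurable_EFinP.
      by apply: measurable_funM => //; exact: mg.
    by move=> w Dw; under eq_bigr do rewrite -EFinM; rewrite sumEFin lee_fin; exact: bound.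
  by rewrite integral_cst// muD mule1.
rewrite ge0_integral_sum//; first last.
- by move=> x w _; rewrite -EFinM lee_fin mulr_ge0 ?powR_ge0.
- by move=> x; apply/measurable_EFinP; apply: measurable_funM => //; exact: mg.
apply: (@le_trans _ _ (\sum_(x : I * L)
  (c x.1 x.2 * (A `^ q * U x.1 x.2 `^ (q / 2)))%:E)%E); last first.
  apply: lee_sum => x _; rewrite ge0_integralZl//; first last.
  - by rewrite lee_fin.
  - by move=> w _; rewrite lee_fin powR_ge0.
  - exact/measurable_EFinP/mg.
  by rewrite EFinM lee_wpmul2l ?lee_fin// Ig.
rewrite sumEFin lee_fin -(pair_bigA _ (fun i l => c i l * (A `^ q * U i l `^ (q / 2))))/=.
rewrite mulr_sumr; apply: ler_sum => i _.
rewrite [leRHS](bigID (P i))/= ler_wpDr//.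
  by apply: sumr_ge0 => l _; rewrite !mulr_ge0 ?powR_ge0.
have -> : \sum_(l | P i l) c i l * (A `^ q * U i l `^ (q / 2)) =
    A `^ q * (B i `^ (q / 2 - 1) * B i).
  rewrite [in RHS]/B !mulr_sumr; apply: eq_bigr => l Pil; rewrite /c Pil.
  have [->|UN0] := eqVneq (U i l) 0; first by rewrite !(mulr0, mul0r).
  have : U i l `^ (q / 2) != 0 by rewrite powR_eq0 negb_and UN0.
  by move=> ?; field.
rewrite ler_wpM2l ?powR_ge0// -/(B i).
have [->|BN0] := eqVneq (B i) 0; first by rewrite mulr0 powR0.
by rewrite [leRHS]mulrC mulr_powRB1// lt_neqAle; case/andP: th01 => -> _; rewrite eq_sym qh0.
Qed.

(** Convexity of the power q, from the concavity of its inverse function. *)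
Lemma powR_midpoint (x y : R) : 0 <= x -> 0 <= y ->
  ((x + y) / 2) `^ q <= (x `^ q + y `^ q) / 2.
Proof.
move=> x0 y0; have /andP[q1 _] := q12; have q0 : 0 < q := lt_le_trans ltr01 q1.
pose w (b : bool) := if b then x else y.
have w0 b : 0 <= w b by case: b.
have qV : 0 <= q^-1 <= 1 by rewrite invr_ge0 (ltW q0) invf_le1.
have h0 : 0 <= 2^-1 :> R by rewrite invr_ge0.
have := @sum_powR_concave R bool predT (fun=> 2^-1) (fun b => w b `^ q) q^-1
  (fun _ _ => h0) (fun b _ => powR_ge0 _ _) qV.
rewrite !big_bool/= -!powRrM divff ?gt_eqF// !powRr1//.
rewrite (_ : 2^-1 + 2^-1 = 1 :> R); last by field.
rewrite powR1 mul1r -!mulrDr => /(ge0_ler_powR (ltW q0)).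
rewrite !nnegrE mulr_ge0 ?addr_ge0// powR_ge0 => /(_ isT isT).
rewrite -powRrM mulVf ?gt_eqF// powRr1 ?mulr_ge0 ?addr_ge0 ?powR_ge0//.
by rewrite ![2^-1 * _]mulrC.
Qed.

(** Average over all signs z. Flipping all signs but that of f i and adding the
two sums leaves twice the selected term, so the midpoint inequality bounds the
mean of the i-th term below. *)
Lemma sign_selection (I : finType) (n : nat) (a : I -> 'I_n -> K) (f : I -> 'I_n) (M : R) :
  (forall z : 'I_n -> K, (forall j, modulus (z j) <= 1) ->
    \sum_i modulus (\sum_j a i j * z j) `^ q <= M) ->
  \sum_i modulus (a i (f i)) `^ q <= M.
Proof.
move=> HM; have /andP[q1 _] := q12; have q0 : 0 < q := lt_le_trans ltr01 q1.
pose s (b : bool) : K := if b then - 1 else 1.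
pose X i (e : {ffun 'I_n -> bool}) := \sum_j a i j * s (e j).
have HX e : \sum_i modulus (X i e) `^ q <= M.
  by apply: HM => j; rewrite /s; case: (e j); rewrite ?modulusN1 ?modulus1.
pose flip h (e : {ffun 'I_n -> bool}) := [ffun j => if j == h then e j else ~~ e j].
have flipK h : involutive (flip h).
  by move=> e; apply/ffunP => j; rewrite !ffunE; case: eqP => // _; rewrite negbK.
have avg i e : modulus (a i (f i)) `^ q <=
    (modulus (X i e) `^ q + modulus (X i (flip (f i) e)) `^ q) / 2.
  apply: le_trans (powR_midpoint (modulus_ge0 _) (modulus_ge0 _)).
  rewrite ge0_ler_powR ?nnegrE ?(ltW q0) ?modulus_ge0//.
    by rewrite divr_ge0 ?addr_ge0 ?modulus_ge0.
  rewrite ler_pdivlMr// -(modulus2 R k) -modulusM.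
  apply: le_trans (modulusD _ _).
  rewrite /X (bigD1 (f i))//= [X in _ + X](bigD1 (f i))//= addrACA.
  rewrite -[X in _ + X]big_split/= [X in _ + X]big1 ?addr0; last first.
    move=> j jf; rewrite ffunE (negbTE jf) -mulrDr /s.
    by case: (e j); rewrite /= ?subrr ?addNr mulr0.
  rewrite ffunE eqxx (_ : a i (f i) * s (e (f i)) + a i (f i) * s (e (f i)) =
    a i (f i) * 2 * s (e (f i))); last by ring.
  rewrite [leRHS]modulusM (_ : modulus (s _) = 1) ?mulr1//.
  by rewrite /s; case: (e _); rewrite ?modulusN1 ?modulus1.
have card0 : 0 < #|{ffun 'I_n -> bool}|%:R :> R.
  by rewrite ltr0n; apply/card_gt0P; exists [ffun=> true].
rewrite -(ler_pM2l card0) !mulr_natl -!sumr_const.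
apply: (@le_trans _ _ (\sum_(e : {ffun 'I_n -> bool})
  \sum_i modulus (X i e) `^ q)); last first.
  by apply: ler_sum => e _; exact: HX.
rewrite sumr_const exchange_big/= -sumrMnl; apply: ler_sum => i _.
rewrite -sumr_const; apply: le_trans (ler_sum _ (fun e _ => avg i e)) _.
rewrite -mulr_suml big_split/= [X in _ + X](reindex_inj (inv_inj (flipK (f i))))/=.
under [X in _ + X]eq_bigr do rewrite flipK.
by set S := \sum_e _; lra.
Qed.

End VectorKhinchin.

(** * Eliminating all variables but one *)

Section Multilinear.
Context (K : numFieldType) (m n : nat) (T : ('I_m -> 'rV[K]_n) -> K).
Hypothesis hT : multilinear_form T.

Lemma multilinear0 v l : T (dfwith v l 0) = 0.
Proof.
have := hT v l 1 0 0; rewrite scaler0 addr0 mul1r => /eqP.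
by rewrite -subr_eq subrr eq_sym => /eqP.
Qed.

Lemma multilinear_row v l (y : 'I_n -> K) :
  T (dfwith v l (\row_a y a)) = \sum_a T (dfwith v l (unit_vec K a)) * y a.
Proof.
have -> : \row_a y a = \sum_a y a *: unit_vec K a.
  apply/rowP => a; rewrite mxE summxE (bigD1 a)//= big1 ?addr0 => [|b ba].
    by rewrite !mxE !eqxx mulr1.
  by rewrite !mxE eqxx eq_sym (negbTE ba) mulr0.
elim/big_rec2: _ => [|a x y' _ <-]; first exact: multilinear0.
by rewrite hT mulrC.
Qed.

(** The arguments of T after the variables in s have been eliminated: these receive the
vectors z, the others are still the basis vectors given by j. *)
Definition mixed_arguments (s : seq 'I_m) (z : 'I_m -> 'I_n -> K)
  (j : {ffun 'I_m -> 'I_n})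
  : 'I_m -> 'rV[K]_n :=
  fun l => if l \in s then \row_a z l a else unit_vec K (j l).

Definition update_index (j : {ffun 'I_m -> 'I_n}) (l : 'I_m) (a : 'I_n)
  : {ffun 'I_m -> 'I_n} :=
  [ffun l' => if l' == l then a else j l'].

Lemma update_index_id j l : update_index j l (j l) = j.
Proof. by apply/ffunP => l'; rewrite ffunE; case: eqP => // ->. Qed.

(** Expanding T along the variable l: this is the linear combination of values
to which the averaging lemmas apply. *)
Lemma mixed_arguments_cons l s z y j : l \notin s ->
  T (mixed_arguments (l :: s) (dfwith z l y) j) =
  \sum_a T (mixed_arguments s z (update_index j l a)) * y a.
Proof.
move=> ls.
have -> : mixed_arguments (l :: s) (dfwith z l y) j =
    dfwith (mixed_arguments s z j) l (\row_a y a).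
  apply/funext => l'; rewrite /mixed_arguments inE; have [->|ll'] := eqVneq l' l.
    by rewrite !dfwithin.
  by rewrite !dfwithout 1?eq_sym.
rewrite multilinear_row; apply: eq_bigr => a _; congr (T _ * _).
apply/funext => l'; rewrite /mixed_arguments; have [->|ll'] := eqVneq l' l.
  by rewrite dfwithin (negbTE ls) ffunE eqxx.
by rewrite dfwithout 1?eq_sym// ffunE (negbTE ll').
Qed.

End Multilinear.

Section Elimination.
Context (R : realType) (k : scalars) (q : R).
Local Notation K := (scalar_field R k).
Hypothesis q12 : 1 <= q <= 2.
Context (m n : nat) (T : ('I_m -> 'rV[K]_n) -> K).
Hypothesis hT : multilinear_form T.
Variables (i : 'I_m) (a0 : 'I_n).
Local Notation index := {ffun 'I_m -> 'I_n}.
Local Notation A := (khinchin_const k q).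

Definition polydisc (z : 'I_m -> 'I_n -> K) := forall l a, modulus (z l a) <= 1.

Lemma polydisc_dfwith z l y : polydisc z -> (forall a, modulus (y a) <= 1) ->
  polydisc (dfwith z l y).
Proof.
move=> hz hy l' a; have [->|ll'] := eqVneq l' l; first by rewrite dfwithin.
by rewrite dfwithout 1?eq_sym.
Qed.

(** The multi-indices keep all their m coordinates during the elimination, so those in
s, on which the arguments of T no longer depend, are frozen at a0. *)
Let at0 (s : seq 'I_m) (j : index) := all (fun l => j l == a0) s.

Lemma at0_update_index s j l a : l \notin s -> at0 s (update_index j l a) = at0 s j.
Proof.
move=> ls; apply: eq_in_all => l' l's; rewrite ffunE; case: (l' =P l) => // ll'.
by move: l's; rewrite ll' (negbTE ls).
Qed.

Lemma sum_update_index (s : seq 'I_m) l b (F : index -> R) : l \notin s -> l != i ->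
  \sum_(j : index | (j i == b) && at0 s j) F j =
  \sum_(j : index | (j i == b) && at0 (l :: s) j) \sum_a F (update_index j l a).
Proof.
move=> ls li; rewrite pair_big_dep/=.
rewrite (reindex_onto (fun x : index * 'I_n => update_index x.1 l x.2)
  (fun j : index => (update_index j l a0, j l)))/=; last first.
  by move=> j _; apply/ffunP => l'; rewrite !ffunE; case: eqP => // ->.
apply: eq_bigl => -[j a] /=; rewrite at0_update_index// ffunE [i == l]eq_sym (negbTE li).
have -> : ((update_index (update_index j l a) l a0, update_index j l a l) == (j, a)) =
    (j l == a0).
  rewrite xpair_eqE (_ : update_index j l a l = a) ?eqxx ?andbT; last by rewrite ffunE eqxx.
  apply/eqP/eqP => [/ffunP/(_ l)|jl]; first by rewrite !ffunE eqxx => ->.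
  by apply/ffunP => l'; rewrite !ffunE; case: (l' =P l) => // ->.
by rewrite andbT -andbA; congr (_ && _); rewrite andbC.
Qed.

(** The mixed sum that remains after eliminating the variables in s. *)
Let Phi (s : seq 'I_m) z : R := \sum_b
  (\sum_(j : index | (j i == b) && at0 s j)
     modulus (T (mixed_arguments s z j)) ^+ 2) `^ (q / 2).

(** Each eliminated variable costs one factor A^q: [vector_khinchin] is applied with the
value of the i-th coordinate as outer index and the multi-indices as inner ones. *)
Lemma eliminate_square (s : seq 'I_m) z (M : R) : uniq s -> i \notin s -> polydisc z ->
  (forall z', polydisc z' -> Phi s z' <= M) ->
  A `^ q ^+ size s * Phi [::] z <= M.
Proof.
have A0 : 0 < A `^ q by rewrite powR_gt0// khinchin_const_gt0.
elim: s M => [|l s IH] M /=; first by move=> _ _ hz; rewrite expr0 mul1r; apply.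
move=> /andP[ls us]; rewrite inE negb_or => /andP[il iNs] hz HM.
rewrite exprS -mulrA -ler_pdivlMl//; apply: IH => // z' hz'.
rewrite ler_pdivlMl//.
have n0 : (0 < n)%N by apply: leq_ltn_trans (ltn_ord a0).
have li : l != i by rewrite eq_sym.
have -> : Phi s z' = \sum_b (\sum_(j : index | (j i == b) && at0 (l :: s) j)
    \sum_a modulus (T (mixed_arguments s z' (update_index j l a))) ^+ 2) `^ (q / 2).
  apply: eq_bigr => b _; congr (_ `^ _).
  exact: (sum_update_index b (fun j => modulus (T (mixed_arguments s z' j)) ^+ 2)).
have := @vector_khinchin R k q q12 'I_n index n
  (fun b j => (j i == b) && at0 (l :: s) j)
  (fun b j a => T (mixed_arguments s z' (update_index j l a))) M n0; apply => y hy.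
have := HM _ (polydisc_dfwith l hz' hy); apply: le_trans.
rewrite le_eqVlt; apply/orP; left; apply/eqP.
apply: eq_bigr => b _; congr (_ `^ _); apply: eq_bigr => j _.
by rewrite mixed_arguments_cons.
Qed.

(** No constant is lost here, although the multi-index f b depends on b:
[sign_selection] allows one selection for each summand. *)
Lemma eliminate_max (f : 'I_n -> index) (s : seq 'I_m) z (M : R) :
  uniq s -> i \notin s -> polydisc z ->
  (forall z', polydisc z' -> \sum_b modulus (T (mixed_arguments s z' (f b))) `^ q <= M) ->
  \sum_b modulus (T (mixed_arguments [::] z (f b))) `^ q <= M.
Proof.
elim: s => [|l s IH] /=; first by move=> _ _ hz; apply.
move=> /andP[ls us]; rewrite inE negb_or => /andP[il iNs] hz HM.
apply: IH => // z' hz'.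
have := @sign_selection R k q q12 'I_n n
  (fun b a => T (mixed_arguments s z' (update_index (f b) l a))) (fun b => f b l) M.
under eq_bigr do rewrite update_index_id.
apply => y hy; have := HM _ (polydisc_dfwith l hz' hy); apply: le_trans.
rewrite le_eqVlt; apply/orP; left; apply/eqP.
by apply: eq_bigr => b _; rewrite mixed_arguments_cons.
Qed.

Lemma sum_powR_le (I : finType) (F : I -> R) : (forall b, 0 <= F b) ->
  \sum_b F b `^ q <= (\sum_b F b) `^ q.
Proof.
move=> F0; have /andP[q1 _] := q12; have q0 : 0 < q := lt_le_trans ltr01 q1.
set S := \sum_b F b; have S0 : 0 <= S by exact: sumr_ge0.
rewrite -(mulr_powRB1 S0 q0) mulr_suml; apply: ler_sum => b _.
rewrite -(mulr_powRB1 (F0 b) q0) ler_wpM2l// ge0_ler_powR ?nnegrE ?subr_ge0//.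
by rewrite /S (bigD1 b)//= ler_wpDr// sumr_ge0.
Qed.

(** Choosing phases turns the sum of the moduli into a value of the form; the sum of the
q-th powers is smaller because q >= 1. *)
Lemma sum_last_variable v (B : R) :
  (forall y : 'I_n -> K, (forall a, modulus (y a) <= 1) ->
    modulus (T (dfwith v i (\row_a y a))) <= B) ->
  \sum_b modulus (T (dfwith v i (unit_vec K b))) `^ q <= B `^ q.
Proof.
move=> HB; apply: le_trans (sum_powR_le _) _ => [b|]; first exact: modulus_ge0.
have /choice[y hy] := fun b => exists_phase (T (dfwith v i (unit_vec K b))).
have /andP[q1 _] := q12; have q0 : 0 <= q := le_trans ler01 q1.
have S0 : 0 <= \sum_b modulus (T (dfwith v i (unit_vec K b))).
  by apply: sumr_ge0 => b _; exact: modulus_ge0.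
have SB : \sum_b modulus (T (dfwith v i (unit_vec K b))) <= B.
  apply: le_trans (HB y (fun a => (hy a).1)).
  rewrite multilinear_row// (eq_bigr _ (fun a _ => (hy a).2)) -embed_real_sum.
  by rewrite modulus_embed_real ger0_norm.
by rewrite ge0_ler_powR ?nnegrE// (le_trans S0).
Qed.

End Elimination.

(** * Mixed sums of a form bounded on the polydisc *)

Section MixedSum.
Context (R : realType) (k : scalars) (q : R).
Local Notation K := (scalar_field R k).
Hypothesis q12 : 1 <= q <= 2.
Context (m n : nat) (T : ('I_m -> 'rV[K]_n) -> K).
Hypothesis hT : multilinear_form T.
Local Notation index := {ffun 'I_m -> 'I_n}.
Local Notation A := (khinchin_const k q).
Local Notation rows z := (fun l => \row_a z l a).
Local Notation coef j := (T (fun l => unit_vec K (j l))).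

Lemma mixed_arguments_all_but (i : 'I_m) (z : 'I_m -> 'I_n -> K) (j : index) :
  mixed_arguments (enum (predC1 i)) z j =
  dfwith (rows z : 'I_m -> 'rV[K]_n) i (unit_vec K (j i)).
Proof.
apply/funext => l; rewrite /mixed_arguments mem_enum inE.
have [->|li] := eqVneq l i; first by rewrite dfwithin.
by rewrite dfwithout 1?eq_sym.
Qed.

Section Interpolation.
Variables (B : R) (i : 'I_m).
Hypothesis HB : forall z, polydisc z -> modulus (T (rows z)) <= B.

Lemma sum_unit_last z : polydisc z ->
  \sum_b modulus (T (dfwith (rows z : 'I_m -> 'rV[K]_n) i (unit_vec K b))) `^ q <= B `^ q.
Proof.
move=> hz; apply: sum_last_variable => // y hy.
rewrite (_ : dfwith _ _ _ = rows (dfwith z i y)); last first.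
  apply/funext => l; have [->|li] := eqVneq l i; first by rewrite !dfwithin.
  by rewrite !dfwithout 1?eq_sym.
by apply: HB; exact: polydisc_dfwith.
Qed.

Let polydisc1 : polydisc (fun (_ : 'I_m) (_ : 'I_n) => 1 : K).
Proof. by move=> l a; rewrite modulus1. Qed.

Let uniq_others : uniq (enum (predC1 i)).
Proof. exact: enum_uniq. Qed.

Let i_notin_others : i \notin enum (predC1 i).
Proof. by rewrite mem_enum inE eqxx. Qed.

Lemma mixed_square_sum (a0 : 'I_n) :
  A `^ q ^+ m.-1 *
    \sum_b (\sum_(j : index | j i == b) modulus (coef j) ^+ 2) `^ (q / 2) <= B `^ q.
Proof.
have q0 : 0 < q by case/andP: q12 => + _; exact: lt_le_trans.
have := eliminate_square q12 hT (a0 := a0) uniq_others i_notin_others polydisc1 (M := B `^ q).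
rewrite -cardE cardC1 card_ord.
set lhs := (X in X <= _) => H.
have -> : A `^ q ^+ m.-1 * \sum_b (\sum_(j : index | j i == b)
   modulus (coef j) ^+ 2) `^ (q / 2) = lhs.
  congr (_ * _); apply: eq_bigr => b _; congr (_ `^ _).
  by apply: eq_bigl => j; rewrite andbT.
apply: H => z hz; apply: le_trans (sum_unit_last hz).
rewrite le_eqVlt; apply/orP; left; apply/eqP.
apply: eq_bigr => b _.
rewrite (big_pred1 (update_index [ffun=> a0] i b)) => [|j].
  rewrite mixed_arguments_all_but ffunE eqxx -powR_mulrn ?modulus_ge0// -powRrM.
  by rewrite mulrCA divff// mulr1.
rewrite /=; apply/andP/eqP => [[/eqP jb /allP j0]|->].
  apply/ffunP => l; rewrite !ffunE; have [->//|li] := eqVneq l i.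
  by apply/eqP/j0; rewrite mem_enum inE.
rewrite ffunE eqxx; split => //; apply/allP => l; rewrite mem_enum inE => li.
by rewrite !ffunE (negbTE li).
Qed.

Lemma mixed_max_sum (f : 'I_n -> index) : (forall b, f b i = b) ->
  \sum_b modulus (coef (f b)) `^ q <= B `^ q.
Proof.
move=> fi.
have := eliminate_max q12 hT (f := f) uniq_others i_notin_others polydisc1 (M := B `^ q).
apply => z hz; apply: le_trans (sum_unit_last hz).
rewrite le_eqVlt; apply/orP; left; apply/eqP.
by apply: eq_bigr => b _; rewrite mixed_arguments_all_but fi.
Qed.

(** With N_b the largest modulus in the slice b and V_b its sum of squares, the sum of
the s-th powers is at most N_b^(s-2) V_b; Hoelder's inequality then combines
[mixed_max_sum] and [mixed_square_sum]. *)
Lemma mixed_sum (a0 : 'I_n) (s : R) : 2 <= s -> 0 <= B ->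
  \sum_b (\sum_(j : index | j i == b) modulus (coef j) `^ s) `^ (q / s) <=
  (A `^ (- 2 * (m%:R - 1) / s) * B) `^ q.
Proof.
move=> s2 B0; have s0 : 0 < s by apply: lt_le_trans s2.
have q0 : 0 < q by case/andP: q12 => + _; exact: lt_le_trans.
have A0 : 0 < A by exact: khinchin_const_gt0.
have m0 : (0 < m)%N by exact: leq_ltn_trans (ltn_ord i).
have th01 : 0 <= 2 / s <= 1 by rewrite divr_ge0 ?(ltW s0)//= ler_pdivrMr// mul1r.
pose N j := modulus (coef j).
have N0 (j : index) : 0 <= N j by exact: modulus_ge0.
pose j0 b : index := update_index [ffun=> a0] i b.
have j0i b : j0 b i == b by rewrite ffunE eqxx.
pose f b : index := [arg max_(j > j0 b | j i == b) N j]%O.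
have fi b : f b i = b by rewrite /f; case: arg_maxP => // j /eqP.
have fmax b (j : index) : j i == b -> N j <= N (f b).
  by rewrite /f; case: arg_maxP => // j' _; apply.
have sq := mixed_square_sum a0; have mx := mixed_max_sum fi.
pose V b := \sum_(j : index | j i == b) N j ^+ 2.
have V0 b : 0 <= V b by apply: sumr_ge0 => j _; exact: sqr_ge0.
apply: (@le_trans _ _ (\sum_b (N (f b) `^ q) `^ (1 - 2 / s) * (V b `^ (q / 2)) `^ (2 / s))).
  apply: ler_sum => b _.
  have -> : (N (f b) `^ q) `^ (1 - 2 / s) * (V b `^ (q / 2)) `^ (2 / s) =
      (N (f b) `^ (s - 2) * V b) `^ (q / s).
    rewrite powRM ?powR_ge0// -!powRrM; congr (_ `^ _ * _ `^ _).
      by field; rewrite gt_eqF.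
    by field; rewrite gt_eqF.
  rewrite ge0_ler_powR ?nnegrE ?divr_ge0 ?(ltW s0) ?(ltW q0)//.
  - by apply: sumr_ge0 => j _; exact: powR_ge0.
  - by rewrite mulr_ge0 ?powR_ge0.
  rewrite mulr_sumr; apply: ler_sum => j jb.
  have [Nz|NN0] := eqVneq (N j) 0.
    by rewrite -/(N j) Nz powR0 ?gt_eqF// expr0n mulr0.
  rewrite -/(N j) -[X in N j `^ X](subrK 2 s) [X in X <= _]powRD ?NN0 ?implybT//.
  rewrite -(powR_mulrn 2 (N0 j)) ler_wpM2r ?powR_ge0// ge0_ler_powR ?nnegrE ?subr_ge0//.
  exact: fmax.
apply: le_trans (sum_hoelder _ _ th01) _ => [b _|b _|]; [exact: powR_ge0|exact: powR_ge0|].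
have Aq0 : 0 < A `^ q ^+ m.-1 by rewrite exprn_gt0// powR_gt0.
have {}sq : \sum_b V b `^ (q / 2) <= B `^ q / A `^ q ^+ m.-1 by rewrite ler_pdivlMr// mulrC.
have /andP[th0 th1] := th01.
apply: (@le_trans _ _ ((B `^ q) `^ (1 - 2 / s) * (B `^ q / A `^ q ^+ m.-1) `^ (2 / s))).
  apply: ler_pM; rewrite ?powR_ge0//; apply: ge0_ler_powR => //;
    rewrite ?nnegrE ?subr_ge0 ?powR_ge0//.
  - by apply: sumr_ge0 => b _; exact: powR_ge0.
  - by apply: sumr_ge0 => b _; exact: powR_ge0.
  - by rewrite divr_ge0 ?powR_ge0 ?(ltW Aq0).
have [->|BN0] := eqVneq B 0.
  rewrite mulr0 !(@powR0 _ q) ?gt_eqF// mul0r [X in _ * X]powR0 ?mulr0//.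
  by rewrite gt_eqF// divr_gt0.
rewrite [X in _ * X]powRM ?powR_ge0 ?invr_ge0 ?(ltW Aq0)// mulrA -powRD; last first.
  by rewrite powR_eq0 (negbTE BN0) implybT.
rewrite subrK powRr1 ?powR_ge0// powRM ?powR_ge0// mulrC.
rewrite le_eqVlt; apply/orP; left; apply/eqP; congr (_ * _).
rewrite -powR_mulrn ?powR_ge0// -!powRrM -powRN -powRrM.
congr (_ `^ _); rewrite -subn1 natrB//; field; by rewrite gt_eqF.
Qed.

End Interpolation.

Lemma multilinear_scale (c : 'I_m -> K) (v : 'I_m -> 'rV[K]_n) :
  T (fun l => c l *: v l) = (\prod_l c l) * T v.
Proof.
have step (s : seq 'I_m) : uniq s ->
    T (fun l => if l \in s then c l *: v l else v l) = (\prod_(l <- s) c l) * T v.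
  elim: s => [|l s IH] /=; first by rewrite big_nil mul1r.
  move=> /andP[ls us]; rewrite big_cons -mulrA -IH//.
  have -> : (fun l' => if l' \in l :: s then c l' *: v l' else v l') =
      dfwith (fun l => if l \in s then c l *: v l else v l) l (c l *: v l + 0).
    apply/funext => l'; rewrite inE; have [->|ll'] := eqVneq l' l.
      by rewrite dfwithin addr0.
    by rewrite dfwithout 1?eq_sym.
  rewrite hT (multilinear0 hT) addr0; congr (_ * T _).
  apply/funext => l'; have [->|ll'] := eqVneq l' l.
    by rewrite dfwithin (negbTE ls).
  by rewrite dfwithout 1?eq_sym.
have := step (index_enum 'I_m) (index_enum_uniq _).
by under [X in T X]eq_fun do rewrite mem_index_enum.
Qed.

(** Each elimination step costs a factor n. This ensures that the supremum in
[form_norm] is an upper bound. *)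
Lemma polydisc_bounded : exists C, forall z, polydisc z -> modulus (T (rows z)) <= C.
Proof.
pose C0 := \sum_(j : index) modulus (coef j).
have step (s : seq 'I_m) z : uniq s -> polydisc z ->
    forall j : index, modulus (T (mixed_arguments s z j)) <= n%:R ^+ size s * C0.
  move=> + hz; elim: s => [_ j|l s IH /= /andP[ls us] j].
    by rewrite expr0 mul1r /C0 (bigD1 j)//= lerDl sumr_ge0// => *; exact: modulus_ge0.
  have zE : dfwith z l (z l) = z.
    apply/funext => l'; have [->|ll'] := eqVneq l' l; first by rewrite dfwithin.
    by rewrite dfwithout 1?eq_sym.
  rewrite -{1}zE (mixed_arguments_cons hT)//; apply: le_trans (modulus_sum _ _ _) _.
  rewrite exprS -mulrA mulr_natl -[X in _ *+ X](card_ord n) -sumr_const.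
  apply: ler_sum => a _; rewrite modulusM.
  apply: (le_trans _ (IH us (update_index j l a))); rewrite ler_piMr ?modulus_ge0//; exact: hz.
have [a0|] := pickP (pred_of_simpl (@predT 'I_n)); last first.
  move=> n0; exists (modulus (T (fun=> 0))) => z _.
  rewrite le_eqVlt; apply/orP; left; apply/eqP; congr (modulus (T _)).
  by apply/funext => l; apply/rowP => a; have := n0 a.
move=> _; exists (n%:R ^+ size (enum 'I_m) * C0) => z hz.
have := step (enum 'I_m) z (enum_uniq _) hz [ffun=> a0].
rewrite (_ : mixed_arguments _ _ _ = rows z)//.
by apply/funext => l; rewrite /mixed_arguments mem_enum.
Qed.

Lemma modulus_le_lp_norm (p : R) (x : 'rV[K]_n) a : 0 < p ->
  modulus (x ord0 a) <= lp_norm p x.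
Proof.
move=> p0; rewrite /lp_norm -[leLHS]powRr1 ?modulus_ge0//.
rewrite -[X in _ `^ X](divff (lt0r_neq0 p0)) powRrM.
apply: ge0_ler_powR; rewrite ?invr_ge0 ?nnegrE ?(ltW p0)//.
- exact: powR_ge0.
- by apply: sumr_ge0 => b _; exact: powR_ge0.
by rewrite (bigD1 a)//= lerDl sumr_ge0// => b _; exact: powR_ge0.
Qed.

Lemma le_form_norm (p : R) (x : 'I_m -> 'rV[K]_n) : 0 < p ->
  (forall l, lp_norm p (x l) <= 1) -> modulus (T x) <= form_norm p T.
Proof.
move=> p0 x1; apply: ub_le_sup; last by exists x.
have [C HC] := polydisc_bounded.
exists C => _ [y y1 <-].
have -> : y = rows (fun l a => y l ord0 a).
  by apply/funext => l; apply/rowP => a; rewrite mxE.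
by apply: HC => l a; apply: le_trans (modulus_le_lp_norm _ _ p0) (y1 l).
Qed.

Lemma form_norm_ge0 (p : R) : 0 < p -> 0 <= form_norm p T.
Proof.
move=> p0; apply: le_trans (le_form_norm (x := fun=> 0) p0 _); first exact: modulus_ge0.
move=> l; rewrite /lp_norm big1 ?powR0 ?ler01 ?invr_eq0 ?gt_eqF// => a _.
by rewrite mxE modulus0 powR0// gt_eqF.
Qed.

End MixedSum.

(** * The choice of the weights *)

Section Weights.
Context (R : realType).

Lemma powR_prod (I : finType) (P : pred I) (F : I -> R) (s : R) :
  (forall i, 0 <= F i) -> (\prod_(i | P i) F i) `^ s = \prod_(i | P i) F i `^ s.
Proof.
move=> F0; have [] : 0 <= \prod_(i | P i) F i /\
    (\prod_(i | P i) F i) `^ s = \prod_(i | P i) F i `^ s => //.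
elim/big_rec2: _ => [|i x y Pi [y0 <-]]; first by rewrite powR1.
by rewrite mulr_ge0// powRM.
Qed.

(** Testing the hypothesis on powers of the marginals mu of the probability u. The
measure u is tilted by S^(e-1) so that its i0-th marginal is S^e / W, the
distribution of the mass in the conclusion; then W factors out ([key]), and it
remains to show that the sum over j of u_j Y_ij is at least 1 in the mean
over i <> i0 ([avgY]). *)
Lemma weighted_sum_bound (m n : nat) (t : {ffun 'I_m -> 'I_n} -> R)
    (q p s eta D : R) (i0 : 'I_m) :
  (2 <= m)%N -> 0 < q -> 0 < p -> 0 < s -> 0 < eta -> 0 <= D ->
  eta^-1 = s^-1 - p^-1 -> s^-1 = q^-1 - (m%:R - 1) / p ->
  (forall j, 0 <= t j) ->
  (forall x : 'I_m -> 'I_n -> R, (forall l a, 0 <= x l a) ->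
     (forall l, \sum_a x l a `^ p <= 1) -> forall i, i != i0 ->
     \sum_a (\sum_(j : {ffun 'I_m -> 'I_n} | j i == a)
        (t j * \prod_l x l (j l)) `^ s) `^ (q / s) <= D `^ q) ->
  (\sum_a (\sum_(j : {ffun 'I_m -> 'I_n} | j i0 == a) t j `^ s) `^ (s^-1 * eta)) `^ eta^-1 <= D.
Proof.
move=> m2 q0 p0 s0 eta0 D0 Eeta Es t0 HD.
have sN0 : s != 0 by rewrite gt_eqF.
have pN0 : p != 0 by rewrite gt_eqF.
have qN0 : q != 0 by rewrite gt_eqF.
have etaN0 : eta != 0 by rewrite gt_eqF.
have m10 : 0 < m%:R - 1 :> R by rewrite subr_gt0 ltr1n.
pose b j := t j `^ s.
have b0 j : 0 <= b j by exact: powR_ge0.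
pose S a := \sum_(j : {ffun 'I_m -> 'I_n} | j i0 == a) b j.
have S0 a : 0 <= S a by exact: sumr_ge0.
set e := s^-1 * eta.
have e0 : 0 < e by rewrite mulr_gt0 ?invr_gt0.
rewrite -/(S _); set W := \sum_a S a `^ e.
have W0 : 0 <= W by apply: sumr_ge0 => a _; exact: powR_ge0.
have [->|WN0] := eqVneq W 0; first by rewrite powR0// invr_eq0.
have {WN0}W0 : 0 < W by rewrite lt_neqAle eq_sym WN0.
pose u (j : {ffun 'I_m -> 'I_n}) := b j * S (j i0) `^ (e - 1) / W.
have u0 j : 0 <= u j by rewrite divr_ge0 ?mulr_ge0 ?powR_ge0 ?(ltW W0).
pose mu l a := \sum_(j : {ffun 'I_m -> 'I_n} | j l == a) u j.
have mu0 l a : 0 <= mu l a by exact: sumr_ge0.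
have mu_i0 a : mu i0 a = S a `^ e / W.
  rewrite -(mulr_powRB1 (S0 a) e0) /mu {1}/S !mulr_suml; apply: eq_bigr => j /eqP <-.
  by rewrite /u.
have u1 : \sum_j u j = 1.
  rewrite (partition_big (fun j : {ffun 'I_m -> 'I_n} => j i0) predT)//=.
  rewrite (eq_bigr (fun a => S a `^ e / W)); last by move=> a _; rewrite -mu_i0.
  by rewrite -mulr_suml divff// gt_eqF.
have mu1 l : \sum_a mu l a = 1.
  by rewrite -u1 (partition_big (fun j : {ffun 'I_m -> 'I_n} => j l) predT).
pose x l a := mu l a `^ p^-1.
have x0 l a : 0 <= x l a by exact: powR_ge0.
have x1 l : \sum_a x l a `^ p <= 1.
  by rewrite -[leRHS](mu1 l); apply: ler_sum => a _; rewrite -powRrM mulVf ?powRr1.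
have th01 : 0 <= q / s <= 1.
  rewrite divr_ge0 ?(ltW q0) ?(ltW s0)//= ler_pdivrMr// mul1r -lef_pV2 ?posrE// Es gerBl.
  by rewrite divr_ge0 ?(ltW m10) ?(ltW p0).
set th := q / s in th01.
have thE : th - 1 = - ((m%:R - 1) * (q / p)).
  by rewrite /th Es mulrBr divff//; field.
have key j : b j * mu i0 (j i0) `^ (s / p) = W `^ (s / eta) * u j.
  have [Sz|SN0] := eqVneq (S (j i0)) 0.
    have -> : b j = 0 by apply: (psumr_eq0P _ Sz) => // ? _; exact: b0.
    rewrite mul0r /u; have -> : b j = 0 by apply: (psumr_eq0P _ Sz) => // ? _; exact: b0.
    by rewrite !mul0r mulr0.
  rewrite mu_i0 powRM ?powR_ge0 ?invr_ge0 ?(ltW W0)// -powRrM.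
  have ee : e - 1 = e * (s / p).
    rewrite /e; have -> : p^-1 = s^-1 - eta^-1 by rewrite Eeta; ring.
    by field; rewrite ?sN0 ?etaN0 ?pN0.
  have se : s / eta = 1 - s / p by rewrite Eeta; field; rewrite ?sN0 ?etaN0 ?pN0.
  rewrite /u ee se powRB ?(gt_eqF W0) ?implybT// powRr1 ?(ltW W0)//.
  rewrite -(powR_inv1 (ltW W0)) -powRrM mulN1r powRN powR_inv1 ?(ltW W0)//.
  have : W `^ (s / p) != 0 by rewrite gt_eqF// powR_gt0.
  by move=> ?; field; rewrite gt_eqF.
pose c (j : {ffun 'I_m -> 'I_n}) := \prod_(l | l != i0) mu l (j l) `^ (s / p).
have c0 j : 0 <= c j by apply: prodr_ge0 => l _; exact: powR_ge0.
have termE j : (t j * \prod_l x l (j l)) `^ s = W `^ (s / eta) * (u j * c j).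
  rewrite powRM ?prodr_ge0// powR_prod// -/(b j) (bigD1 i0)//= [LHS]mulrA [RHS]mulrA -key /x.
  rewrite -powRrM [_^-1 * _]mulrC; congr (_ * _).
  by apply: eq_bigr => l _; rewrite -powRrM [_^-1 * _]mulrC.
(* What Jensen's inequality leaves of the i-th inequality; for u j > 0 the product
   of the Y i j over i <> i0 is 1, because of thE. *)
pose Y i (j : {ffun 'I_m -> 'I_n}) := mu i (j i) `^ (th - 1) * c j `^ th.
have Y0 i j : 0 <= Y i j by rewrite mulr_ge0 ?powR_ge0.
have lowerY i : i != i0 -> W `^ (q / eta) * \sum_j u j * Y i j <= D `^ q.
  move=> ii0; apply: le_trans (HD x x0 x1 i ii0).
  have -> : \sum_a (\sum_(j : {ffun 'I_m -> 'I_n} | j i == a)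
        (t j * \prod_l x l (j l)) `^ s) `^ th =
      W `^ (q / eta) * \sum_a (\sum_(j : {ffun 'I_m -> 'I_n} | j i == a) u j * c j) `^ th.
    rewrite mulr_sumr; apply: eq_bigr => a _.
    rewrite (eq_bigr (fun j => W `^ (s / eta) * (u j * c j))) => [|j _]; last exact: termE.
    rewrite -mulr_sumr powRM ?powR_ge0//; last by apply: sumr_ge0 => j _; rewrite mulr_ge0.
    rewrite -powRrM (_ : s / eta * th = q / eta)// /th.
    by field; rewrite etaN0 sN0.
  rewrite ler_wpM2l ?powR_ge0// (partition_big (fun j : {ffun 'I_m -> 'I_n} => j i) predT)//=.
  apply: ler_sum => a _.
  have [muz|muN0] := eqVneq (mu i a) 0.
    rewrite big1 ?powR_ge0// => j ja.
    have -> : u j = 0 by apply: (psumr_eq0P _ muz).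
    by rewrite mul0r.
  have := @sum_powR_concave R _ (fun j : {ffun 'I_m -> 'I_n} => j i == a) u c th
    (fun j _ => u0 j) (fun j _ => c0 j) th01.
  rewrite -/(mu i a) => conc.
  have -> : \sum_(j : {ffun 'I_m -> 'I_n} | j i == a) u j * Y i j =
      mu i a `^ (th - 1) * \sum_(j : {ffun 'I_m -> 'I_n} | j i == a) u j * c j `^ th.
    by rewrite mulr_sumr; apply: eq_bigr => j /eqP ja; rewrite /Y ja mulrCA.
  apply: le_trans (ler_wpM2l (powR_ge0 _ _) conc) _.
  rewrite mulrA -powRD; last by rewrite muN0 implybT.
  by rewrite (_ : th - 1 + (1 - th) = 0) ?powRr0 ?mul1r//; ring.
have avgY j : u j * (m%:R - 1) <= u j * \sum_(i | i != i0) Y i j.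
  have [->|uN0] := eqVneq (u j) 0; first by rewrite !mul0r.
  rewrite ler_wpM2l//.
  have mup l : mu l (j l) != 0.
    rewrite gt_eqF// (lt_le_trans (_ : 0 < u j))//; first by rewrite lt_neqAle eq_sym uN0 u0.
    by rewrite /mu (bigD1 j)//= ler_wpDr// sumr_ge0.
  (* The arithmetic-geometric mean inequality through 1 + y <= exp y: the
     exponents of the Y i j add up to 0. *)
  pose L l := ln (mu l (j l)).
  have YE i : Y i j = expR ((th - 1) * L i + q / p * \sum_(l | l != i0) L l).
    rewrite expRD /Y {1}/powR (negbTE (mup i)); congr (_ * _).
    rewrite /c powR_prod => [|l]; last exact: powR_ge0.
    rewrite mulr_sumr expR_sum; apply: eq_bigr => l _.
    rewrite -powRrM /powR (negbTE (mup l)); congr expR; rewrite /L /th.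
    by field; rewrite pN0 sN0.
  have cardE : \sum_(i < m | i != i0) 1 = m%:R - 1 :> R.
    rewrite sumr_const cardC1 card_ord -subn1 natrB//; exact: ltnW.
  rewrite -cardE; apply: (@le_trans _ _ (\sum_(i < m | i != i0)
      (1 + ((th - 1) * L i + q / p * \sum_(l | l != i0) L l)))).
    rewrite big_split/= lerDl big_split/= -mulr_sumr sumr_const cardC1 card_ord -subn1.
    rewrite -[X in _ + X]mulr_natl natrB ?(ltnW m2)// thE; set X := \sum_(_ | _) L _.
    by rewrite le_eqVlt; apply/orP; left; apply/eqP; ring.
  by apply: ler_sum => i _; rewrite YE expR_ge1Dx.
have : (m%:R - 1) * W `^ (q / eta) <= (m%:R - 1) * D `^ q.
  have cardE z : \sum_(i < m | i != i0) z = (m%:R - 1) * z :> R.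
    by rewrite sumr_const cardC1 card_ord -subn1 -[LHS]mulr_natl natrB// ltnW.
  rewrite -[leRHS]cardE.
  apply: le_trans (ler_sum _ lowerY).
  rewrite -mulr_sumr mulrC ler_wpM2l ?powR_ge0// exchange_big/=.
  apply: (@le_trans _ _ (\sum_j u j * (m%:R - 1))).
    by rewrite -mulr_suml u1 mul1r.
  by apply: ler_sum => j _; rewrite -mulr_sumr; exact: avgY.
rewrite ler_pM2l// => H.
have := @ge0_ler_powR R q^-1 _ _ _ _ _ H; rewrite invr_ge0 !nnegrE ?powR_ge0.
move=> /(_ (ltW q0) isT isT); rewrite -!powRrM divff// powRr1//.
by rewrite (_ : q / eta / q = eta^-1)//; field; rewrite qN0 etaN0.
Qed.

End Weights.

(** * The inequality for l_p norms *)

Lemma twisted_multilinear (K : numFieldType) (m n : nat) (T : ('I_m -> 'rV[K]_n) -> K)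
    (c : 'I_m -> 'I_n -> K) :
  multilinear_form T ->
  multilinear_form (fun v : 'I_m -> 'rV[K]_n => T (fun l => \row_a (c l a * v l ord0 a))).
Proof.
move=> hT x l a u v.
have E w : (fun l' => \row_b (c l' b * (dfwith x l w) l' ord0 b)) =
    dfwith (fun l' => \row_b (c l' b * x l' ord0 b)) l (\row_b (c l b * w ord0 b)).
  apply/funext => l'; have [->|ll'] := eqVneq l' l; first by rewrite !dfwithin.
  by rewrite !dfwithout 1?eq_sym.
rewrite !E -hT; congr (T (dfwith _ _ _)).
by apply/rowP => b; rewrite !mxE mulrDr mulrCA.
Qed.

Theorem theorem2 (R : realType) (k : scalars) (m : nat) (lambda0 p : R)
    (hm : (2 <= m)%N) (hlambda0 : 1 <= lambda0 <= 2)
    (hp_lower : lambda0 * m%:R < p)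
    (hp_upper : lambda0 != 2 ->
       p <= 2 * lambda0 * (m%:R - 1) / (2 - lambda0)) :
  let eta1 := lambda0 * p / (p - lambda0 * m%:R) in
  let s := lambda0 * p / (p - lambda0 * m%:R + lambda0) in
  forall (n : nat) (hn : (0 < n)%N)
    (T : ('I_m -> 'rV[scalar_field R k]_n) -> scalar_field R k)
    (hT : multilinear_form T) (i : 'I_m),
  (\sum_(ji < n)
     (\sum_(j : {ffun 'I_m -> 'I_n} | j i == ji)
        modulus (T (fun l => unit_vec (scalar_field R k) (j l))) `^ s)
       `^ (s^-1 * eta1)) `^ eta1^-1
  <= khinchin_const k lambda0 `^ (- 2 * (m%:R - 1) / s) * form_norm p T.
Proof.
move=> eta1 s n hn T hT i.
have /andP[q1 q2] := hlambda0.
have q0 : 0 < lambda0 by exact: lt_le_trans q1.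
have m2 : 2 <= m%:R :> R by rewrite ler_nat.
have p0 : 0 < p by apply: le_lt_trans hp_lower; rewrite mulr_ge0// ltW.
have d0 : 0 < p - lambda0 * m%:R by rewrite subr_gt0.
have d1 : 0 < p - lambda0 * m%:R + lambda0 by rewrite addr_gt0.
have eta0 : 0 < eta1 by rewrite divr_gt0// mulr_gt0.
have s0 : 0 < s by rewrite divr_gt0// mulr_gt0.
have Es : s^-1 = lambda0^-1 - (m%:R - 1) / p.
  by rewrite /s; field; rewrite !gt_eqF.
have Eeta : eta1^-1 = s^-1 - p^-1.
  by rewrite Es /eta1; field; rewrite !gt_eqF.
(* This is where the upper bound on p enters. *)
have s2 : 2 <= s.
  rewrite /s ler_pdivlMr//.
  have [q_eq|/[dup] qN2 /hp_upper] := eqVneq lambda0 2; first by rewrite q_eq; nra.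
  have q2' : 0 < 2 - lambda0 by rewrite subr_gt0 lt_neqAle qN2.
  by rewrite ler_pdivlMr//; nra.
set F := form_norm p T.
have F0 : 0 <= F by exact: form_norm_ge0.
apply: (@weighted_sum_bound R m n (fun j => modulus (T (fun l => unit_vec _ (j l))))
  lambda0 p s eta1 _ i) => //.
  by rewrite mulr_ge0// powR_ge0.
  by move=> j; exact: modulus_ge0.
move=> x x0 x1 i' _.
pose c l a := embed_real k (x l a).
have cE l a : modulus (c l a) = x l a by rewrite modulus_embed_real ger0_norm.
pose T' (v : 'I_m -> 'rV[scalar_field R k]_n) := T (fun l => \row_a (c l a * v l ord0 a)).
have hT' : multilinear_form T' by exact: twisted_multilinear.
have T'F z : polydisc z -> modulus (T' (fun l => \row_a z l a)) <= F.
  move=> hz; rewrite /T' /F; apply: (le_form_norm hT p0) => l.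
  rewrite /lp_norm [leRHS](_ : 1 = 1 `^ p^-1); last by rewrite powR1.
  rewrite ge0_ler_powR ?nnegrE ?invr_ge0 ?(ltW p0)//.
    by apply: sumr_ge0 => a _; exact: powR_ge0.
  apply: le_trans (x1 l); apply: ler_sum => a _.
  rewrite !mxE modulusM cE ge0_ler_powR ?nnegrE ?(ltW p0)//.
    by rewrite mulr_ge0// modulus_ge0.
  by rewrite ler_piMr.
apply: le_trans (mixed_sum hlambda0 hT' i' T'F (Ordinal hn) s2 F0).
rewrite le_eqVlt; apply/orP; left; apply/eqP.
apply: eq_bigr => a _; congr (_ `^ _); apply: eq_bigr => j _; congr (_ `^ _).
have -> : T' (fun l => unit_vec _ (j l)) = T (fun l => c l (j l) *: unit_vec _ (j l)).
  congr T; apply/funext => l; apply/rowP => b; rewrite !mxE eqxx/=.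
  by case: eqP => [->//|_]; rewrite !mulr0.
rewrite (multilinear_scale hT) modulusM mulrC; congr (_ * _).
by elim/big_rec2: _ => [|l y1 y2 _ ->]; rewrite ?modulus1// modulusM cE.
Qed.
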